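(* Under Assumptions 1 and 2 (stated in the context), in the single-channel case $Q_2=Q_\infty=:Q$, $R_2=R_\infty=:R$, the function $J_{\mathrm{mix}}$ has a unique stationary point in $\mathcal{K}_\beta$, given by $K=-R^{-1}B^{\mathsf T}P$, where $P$ is the stabilizing solution of the Riccati equation $A^{\mathsf T}P+PA+P(\beta^{-2}W-BR^{-1}B^{\mathsf T})P+Q=0$ (i.e. $A+(\beta^{-2}W-BR^{-1}B^{\mathsf T})P$ is Hurwitz).
   Context: Let $A\in\mathbb{R}^{n\times n}$, $B\in\mathbb{R}^{n\times m}$, $B_w\in\mathbb{R}^{n\times n}$, $W:=B_wB_w^{\mathsf T}$. Let $Q$, $R$ be symmetric positive definite weights and $\beta>0$. For $K\in\mathbb{R}^{m\times n}$ write $A_K:=A+BK$, $S_K:=Q+K^{\mathsf T}RK$. Let $\mathcal{K}:=\{K: A_K \text{ Hurwitz}\}$, $\mathbf{T}_\infty(K)(s)=\begin{bmatrix}Q^{1/2}\\ R^{1/2}K\end{bmatrix}(sI-A_K)^{-1}B_w$, $\mathcal{K}_\beta:=\{K\in\mathcal{K}:\|\mathbf{T}_\infty(K)\|_{\mathcal{H}_\infty}<\beta\}$. For $K\in\mathcal{K}_\beta$ the Riccati equation $A_KX+XA_K^{\mathsf T}+\beta^{-2}XS_KX+W=0$ has a unique stabilizing solution $X_K\succeq0$ (i.e. $A_K+\beta^{-2}X_KS_K$ Hurwitz), and $J_{\mathrm{mix}}(K):=\operatorname{tr}((Q+K^{\mathsf T}RK)X_K)$; a stationary point is $K\in\mathcal{K}_\beta$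 with $\nabla J_{\mathrm{mix}}(K)=0$. Assumption 1: $(A,B)$ stabilizable, $(Q^{1/2},A)$ detectable, and $\beta>\inf_{K\in\mathcal{K}}\|\mathbf{T}_\infty(K)\|_{\mathcal{H}_\infty}$. Assumption 2: $W\succ0$ (together with $Q,R\succ0$). *)

(* Defs.v *)
From HB Require Import structures.
From mathcomp Require Import all_boot all_order all_algebra.
From mathcomp Require Import all_classical all_reals all_analysis.
From mathcomp Require Import complex.
From Stdlib Require Import ClassicalEpsilon.
Set Implicit Arguments. Unset Strict Implicit. Unset Printing Implicit Defensive.
Import Order.TTheory GRing.Theory Num.Theory.
Import numFieldNormedType.Exports.
Local Open Scope ring_scope.
Local Open Scope classical_set_scope.

Section Defs.
Variable R : realType.

Definition toC (x : R) : R[i] := (x%:C)%C.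
Definition MtoC m n (M : 'M[R]_(m, n)) : 'M[R[i]]_(m, n) := map_mx toC M.

Definition hurwitz n (M : 'M[R]_n) : Prop :=
  forall lam : R[i], eigenvalue (MtoC M) lam -> complex.Re lam < 0.

Definition symmetric n (M : 'M[R]_n) : Prop := M^T = M.
Definition posdef n (M : 'M[R]_n) : Prop :=
  symmetric M /\ forall x : 'cV[R]_n, x != 0 -> 0 < (x^T *m M *m x) 0 0.
Definition possemidef n (M : 'M[R]_n) : Prop :=
  symmetric M /\ forall x : 'cV[R]_n, 0 <= (x^T *m M *m x) 0 0.

Definition msqrt n (M : 'M[R]_n) : 'M[R]_n :=
  epsilon (inhabits 0) (fun S => possemidef S /\ S *m S = M).

Definition stabilizable n m (A : 'M[R]_n) (B : 'M[R]_(n, m)) : Prop :=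
  exists K : 'M[R]_(m, n), hurwitz (A + B *m K).
Definition detectable p n (C : 'M[R]_(p, n)) (A : 'M[R]_n) : Prop :=
  exists L : 'M[R]_(n, p), hurwitz (A + L *m C).

Definition cvnorm k (v : 'cV[R[i]]_k) : R :=
  Num.sqrt (\sum_i (complex.Re (v i 0) ^+ 2 + complex.Im (v i 0) ^+ 2)).

(* H-infinity norm of the transfer matrix G(s) = C (sI - A)^{-1} D :
   sup over real frequencies w of the largest singular value of G(i w),
   the latter being the sup of |G(iw) v| over unit vectors v *)
Definition hinf_norm p n q (C : 'M[R]_(p, n)) (A : 'M[R]_n) (D : 'M[R]_(n, q)) : R :=
  sup [set r : R | exists (w : R) (v : 'cV[R[i]]_q), cvnorm v = 1 /\
     r = cvnorm (MtoC C *m invmx ((0 +i* w)%C%:M - MtoC A) *m MtoC D *m v)].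

Variables (n m : nat) (A : 'M[R]_n) (B : 'M[R]_(n, m)) (Bw : 'M[R]_n)
  (Q : 'M[R]_n) (Rw : 'M[R]_m) (beta : R).

Definition Wm : 'M[R]_n := Bw *m Bw^T.
Definition AK (K : 'M[R]_(m, n)) : 'M[R]_n := A + B *m K.
Definition SK (K : 'M[R]_(m, n)) : 'M[R]_n := Q + K^T *m Rw *m K.

Definition CK (K : 'M[R]_(m, n)) : 'M[R]_(n + m, n) :=
  col_mx (msqrt Q) (msqrt Rw *m K).

Definition Tinf_norm (K : 'M[R]_(m, n)) : R := hinf_norm (CK K) (AK K) Bw.

Definition Kset (K : 'M[R]_(m, n)) : Prop := hurwitz (AK K).
Definition Kbeta (K : 'M[R]_(m, n)) : Prop := Kset K /\ Tinf_norm K < beta.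

Definition stab_sol_X (K : 'M[R]_(m, n)) (X : 'M[R]_n) : Prop :=
  possemidef X /\
  AK K *m X + X *m (AK K)^T + beta ^- 2 *: (X *m SK K *m X) + Wm = 0 /\
  hurwitz (AK K + beta ^- 2 *: (X *m SK K)).

Definition XK (K : 'M[R]_(m, n)) : 'M[R]_n := epsilon (inhabits 0) (stab_sol_X K).

Definition Jmix (K : 'M[R]_(m, n)) : R := \tr (SK K *m XK K).

Definition stationary (K : 'M[R]_(m, n)) : Prop :=
  Kbeta K /\ differentiable Jmix K /\ 'd Jmix K = (fun _ => 0) :> (_ -> R).

Definition stab_sol_P (P : 'M[R]_n) : Prop :=
  symmetric P /\
  A^T *m P + P *m A + P *m (beta ^- 2 *: Wm - B *m invmx Rw *m B^T) *m P + Q = 0 /\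
  hurwitz (A + (beta ^- 2 *: Wm - B *m invmx Rw *m B^T) *m P).

End Defs.

(* Main.v *)
(** Everything is reduced to Lyapunov certificates and to one Riccati theorem.  Write
    ric N = N A + A^T N + N W N + S with W > 0.  A strict subsolution M (ric M < 0)
    yields, by Newton's iteration from above, a solution N > M with -(A + W N) Hurwitz.
    With S = beta^-2 S_K and W = B_w B_w^T, the H-infinity bound is equivalent to the
    existence of a strict subsolution; the hard direction raises the level g in
    S = g S_K up to the first infeasible value, where the limit solution has an
    imaginary closed-loop eigenvalue, which is a frequency of gain g^(-1/2).  The
    inverse of N is X_K, and completing the square in K gives P.

    For the gradient, X_(K+H) is trapped between X_K + dX(H) -/+ eps |H| N_0, which are
    sub- and supersolutions at K + H, so that J is differentiable with gradient
    2 (R K M + B^T) Y X, where Y is the adjoint Lyapunov solution and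
    M = Y^-1 + beta^-2 X.  It vanishes iff K = - R^-1 B^T M^-1, and M^-1 always solves
    the Riccati equation attached to K; for this K it is the Riccati equation of P. *)
Require Import Defs.
From HB Require Import structures.
From mathcomp Require Import all_boot all_order all_algebra.
From mathcomp Require Import all_classical all_reals all_analysis.
From mathcomp Require Import complex.
From mathcomp Require Import ring lra.
Import Order.TTheory GRing.Theory Num.Theory.
Import numFieldNormedType.Exports.
Local Open Scope ring_scope.
Set Implicit Arguments. Unset Strict Implicit. Unset Printing Implicit Defensive.

(** Spectra are hard to perturb, whereas a quadratic Lyapunov function is a real and open condition;
    hence certificates replace eigenvalues wherever stability must survive a small change or a
    limit. The Riccati theorem wants a definite quadratic term and produces the largest solution,
    whose closed loop is antistable, while [X_K] is the stabilizing solution. Inversion exchanges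
    the quadratic with the constant term and negates the closed loop up to similarity. The same
    device handles [P]: its quadratic term is indefinite, but for the inverse of [P] it becomes the
    constant term, on which no sign is imposed. [XK] is an [epsilon] choice, accessible only through
    uniqueness, so nothing is known beforehand about its dependence on [K]. Trapping by super- and
    subsolutions gives existence near [K] and first-order control at once, and the trace against a
    definite weight turns the trap into an estimate of the cost. The form of [M] comes from the
    gradient: it is the factor that isolates [K]. *)

Section BilinearForms.
Variable R : realType.
Implicit Types (m n p q : nat).

(** * Quadratic forms and the semidefinite order *)

Lemma addmxE m n (M N : 'M[R]_(m, n)) i j : (M + N) i j = M i j + N i j.
Proof. by rewrite mxE. Qed.

Lemma oppmxE m n (M : 'M[R]_(m, n)) i j : (- M) i j = - M i j.
Proof. by rewrite mxE. Qed.

Lemma scalemxE m n a (M : 'M[R]_(m, n)) i j : (a *: M) i j = a * M i j.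
Proof. by rewrite mxE. Qed.

Lemma zeromxE m n i j : (0 : 'M[R]_(m, n)) i j = 0.
Proof. by rewrite mxE. Qed.

Definition bf m n (M : 'M[R]_(m, n)) (x : 'cV[R]_m) (y : 'cV[R]_n) : R :=
  (x^T *m M *m y) 0 0.

Lemma bfDm m n (M N : 'M[R]_(m, n)) x y : bf (M + N) x y = bf M x y + bf N x y.
Proof. by rewrite /bf mulmxDr mulmxDl mxE. Qed.

Lemma bfNm m n (M : 'M[R]_(m, n)) x y : bf (- M) x y = - bf M x y.
Proof. by rewrite /bf mulmxN mulNmx mxE. Qed.

Lemma bfZm m n a (M : 'M[R]_(m, n)) x y : bf (a *: M) x y = a * bf M x y.
Proof. by rewrite /bf -scalemxAr -scalemxAl mxE. Qed.

Lemma bf0m m n x y : bf (0 : 'M[R]_(m, n)) x y = 0.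
Proof. by rewrite /bf mulmx0 mul0mx mxE. Qed.

Lemma bfDl m n (M : 'M[R]_(m, n)) x x' y : bf M (x + x') y = bf M x y + bf M x' y.
Proof. by rewrite /bf linearD !mulmxDl mxE. Qed.

Lemma bfDr m n (M : 'M[R]_(m, n)) x y y' : bf M x (y + y') = bf M x y + bf M x y'.
Proof. by rewrite /bf mulmxDr mxE. Qed.

Lemma bfNl m n (M : 'M[R]_(m, n)) x y : bf M (- x) y = - bf M x y.
Proof. by rewrite /bf linearN !mulNmx mxE. Qed.

Lemma bfNr m n (M : 'M[R]_(m, n)) x y : bf M x (- y) = - bf M x y.
Proof. by rewrite /bf mulmxN mxE. Qed.

Lemma bfZl m n (M : 'M[R]_(m, n)) a x y : bf M (a *: x) y = a * bf M x y.
Proof. by rewrite /bf linearZ -!scalemxAl mxE. Qed.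

Lemma bfZr m n (M : 'M[R]_(m, n)) a x y : bf M x (a *: y) = a * bf M x y.
Proof. by rewrite /bf -scalemxAr mxE. Qed.

Lemma bf0l m n (M : 'M[R]_(m, n)) y : bf M 0 y = 0.
Proof. by rewrite /bf trmx0 !mul0mx mxE. Qed.

Lemma bf0r m n (M : 'M[R]_(m, n)) x : bf M x 0 = 0.
Proof. by rewrite /bf mulmx0 mxE. Qed.

Lemma bf_trmx m n (M : 'M[R]_(m, n)) x y : bf M^T x y = bf M y x.
Proof.
have -> : bf M^T x y = ((y^T *m M *m x)^T) 0 0 by rewrite !trmx_mul trmxK mulmxA.
by rewrite mxE.
Qed.

Lemma bf_mull m n p (A : 'M[R]_(m, p)) (M : 'M[R]_(p, n)) x y :
  bf (A *m M) x y = bf M (A^T *m x) y.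
Proof. by rewrite /bf trmx_mul trmxK !mulmxA. Qed.

Lemma bf_mulr m n p (M : 'M[R]_(m, p)) (A : 'M[R]_(p, n)) x y :
  bf (M *m A) x y = bf M x (A *m y).
Proof. by rewrite /bf !mulmxA. Qed.

Lemma bf_delta m n (M : 'M[R]_(m, n)) i j :
  bf M (delta_mx i 0) (delta_mx j 0) = M i j.
Proof. by rewrite /bf trmx_delta -rowE -colE !mxE. Qed.

Lemma bf1E n (x : 'cV[R]_n) : bf 1%:M x x = \sum_i x i 0 ^+ 2.
Proof. by rewrite /bf mulmx1 mxE; apply: eq_bigr => i _; rewrite mxE expr2. Qed.

Lemma bf1_ge0 n (x : 'cV[R]_n) : 0 <= bf 1%:M x x.
Proof. by rewrite bf1E sumr_ge0 // => i _; rewrite sqr_ge0. Qed.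

Lemma bf1_gt0 n (x : 'cV[R]_n) : x != 0 -> 0 < bf 1%:M x x.
Proof.
move=> x0; rewrite lt_def bf1_ge0 andbT; apply: contra_neq x0.
rewrite bf1E => /psumr_eq0P H; apply/matrixP => i j.
rewrite ord1 mxE; apply/eqP; rewrite -[_ == _]sqrf_eq0; apply/eqP/H => // k _.
by rewrite sqr_ge0.
Qed.

Lemma bf_square n k (C : 'M[R]_(k, n)) x : bf (C^T *m C) x x = bf 1%:M (C *m x) (C *m x).
Proof. by rewrite bf_mull trmxK -[C]mul1mx bf_mulr !mul1mx. Qed.

Lemma posdef_sym n (M : 'M[R]_n) : posdef M -> M^T = M. Proof. by case. Qed.

Lemma psd_sym n (M : 'M[R]_n) : possemidef M -> M^T = M. Proof. by case. Qed.

Lemma posdef_bf n (M : 'M[R]_n) x : posdef M -> x != 0 -> 0 < bf M x x.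
Proof. by case=> _; apply. Qed.

Lemma psd_bf n (M : 'M[R]_n) x : possemidef M -> 0 <= bf M x x.
Proof. by case=> _; apply. Qed.

Lemma posdef_psd n (M : 'M[R]_n) : posdef M -> possemidef M.
Proof.
move=> [sM M0]; split=> // x.
by have [->|/M0/ltW//] := eqVneq x 0; rewrite mulmx0 mxE.
Qed.

Lemma posdef1 n : posdef (1%:M : 'M[R]_n).
Proof. by split; [exact: trmx1 | exact: bf1_gt0]. Qed.

Lemma psd0 n : possemidef (0 : 'M[R]_n).
Proof. by split=> [|x]; [exact: trmx0 | rewrite -/(bf _ _ _) bf0m]. Qed.

Lemma psdD n (M N : 'M[R]_n) : possemidef M -> possemidef N -> possemidef (M + N).
Proof.
move=> [sM M0] [sN N0]; split=> [|x]; first by rewrite /Defs.symmetric linearD /= sM sN.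
by rewrite -/(bf _ _ _) bfDm addr_ge0 ?M0 ?N0.
Qed.

Lemma posdef_psdD n (M N : 'M[R]_n) : posdef M -> possemidef N -> posdef (M + N).
Proof.
move=> [sM M0] [sN N0]; split=> [|x x0]; first by rewrite /Defs.symmetric linearD /= sM sN.
by rewrite -/(bf _ _ _) bfDm ltr_pwDl ?M0 ?N0.
Qed.

Lemma psd_posdefD n (M N : 'M[R]_n) : possemidef M -> posdef N -> posdef (M + N).
Proof. by move=> M0 N0; rewrite addrC; apply: posdef_psdD. Qed.

Lemma psdZ n a (M : 'M[R]_n) : 0 <= a -> possemidef M -> possemidef (a *: M).
Proof.
move=> a0 [sM M0]; split=> [|x]; first by rewrite /Defs.symmetric linearZ /= sM.
by rewrite -/(bf _ _ _) bfZm mulr_ge0 ?M0.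
Qed.

Lemma posdefZ n a (M : 'M[R]_n) : 0 < a -> posdef M -> posdef (a *: M).
Proof.
move=> a0 [sM M0]; split=> [|x x0]; first by rewrite /Defs.symmetric linearZ /= sM.
by rewrite -/(bf _ _ _) bfZm mulr_gt0 ?M0.
Qed.

Lemma psd_congr n p (M : 'M[R]_n) (T : 'M[R]_(n, p)) :
  possemidef M -> possemidef (T^T *m M *m T).
Proof.
move=> [sM M0]; split=> [|x]; first by rewrite /Defs.symmetric !trmx_mul trmxK sM mulmxA.
by rewrite -/(bf _ _ _) bf_mulr bf_mull trmxK; apply: M0.
Qed.

Lemma posdef_congr n (M T : 'M[R]_n) :
  posdef M -> T \in unitmx -> posdef (T^T *m M *m T).
Proof.
move=> [sM M0] Tu; split=> [|x x0]; first by rewrite /Defs.symmetric !trmx_mul trmxK sM mulmxA.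
rewrite -/(bf _ _ _) bf_mulr bf_mull trmxK; apply: M0.
by apply: contra_neq x0 => Tx; rewrite -(mulKmx Tu x) Tx mulmx0.
Qed.

Lemma bf_sym n (M : 'M[R]_n) x y : M^T = M -> bf M x y = bf M y x.
Proof. by move=> sM; rewrite -bf_trmx sM. Qed.

Lemma psd_CauchySchwarz n (M : 'M[R]_n) x y :
  possemidef M -> bf M x y ^+ 2 <= bf M x x * bf M y y.
Proof.
move=> M0; have sM := psd_sym M0.
have key a : 0 <= bf M x x + a * bf M x y *+ 2 + a ^+ 2 * bf M y y.
  have := psd_bf (x + a *: y) M0.
  by rewrite !(bfDl, bfDr, bfZl, bfZr) (bf_sym y x sM) => h; nra.
have := psd_bf y M0; rewrite le_eqVlt => /orP[/eqP y0|y0]; last first.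
  have := key (- bf M x y / bf M y y).
  have -> : bf M x x + (- bf M x y / bf M y y) * bf M x y *+ 2 +
     (- bf M x y / bf M y y) ^+ 2 * bf M y y = bf M x x - bf M x y ^+ 2 / bf M y y.
    by field; rewrite gt_eqF.
  by rewrite subr_ge0 ler_pdivrMr.
rewrite -y0 mulr0; case: (eqVneq (bf M x y) 0) => [->|xy]; first by rewrite expr0n.
(* For isotropic [y] the form is affine along [y]; at this parameter it would equal -1. *)
have := key (- (bf M x x + 1) / bf M x y / 2).
rewrite -y0 mulr0 addr0.
have -> : (- (bf M x x + 1) / bf M x y / 2) * bf M x y *+ 2 = - (bf M x x + 1).
  by field.
by move=> h; lra.
Qed.

Lemma psd_ker n (M : 'M[R]_n) x : possemidef M -> bf M x x = 0 -> M *m x = 0.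
Proof.
move=> M0 x0; apply/eqP; case: (eqVneq (M *m x) 0) => // Mx.
have := psd_CauchySchwarz x (M *m x) M0; rewrite x0 mul0r.
rewrite -[X in bf X]mulmx1 -bf_sym ?trmx_mul ?trmx1 ?mulmx1 ?mul1mx ?psd_sym //.
rewrite -{1}[M]mulmx1 bf_sym ?mulmx1 ?psd_sym //.
have -> : bf M x (M *m x) = bf 1%:M (M *m x) (M *m x).
  by rewrite -{1}[M]mulmx1 bf_mull psd_sym.
by move=> h; have := bf1_gt0 Mx; nra.
Qed.

Lemma posdef_unit n (M : 'M[R]_n) : posdef M -> M \in unitmx.
Proof.
move=> M0; rewrite -unitmx_tr -row_free_unit -kermx_eq0.
apply/eqP/row_matrixP => i; rewrite row0.
have kM : (row i (kermx M^T)) *m M^T = 0 by rewrite -row_mul mulmx_ker row0.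
set v := row _ _ in kM *.
apply/eqP; rewrite -trmx_eq0; apply/negPn/negP => v0.
have := posdef_bf M0 v0; rewrite -[M]mul1mx bf_mulr.
have -> : M *m v^T = 0 by rewrite -[M]trmxK -trmx_mul kM trmx0.
by rewrite bf0r ltxx.
Qed.

Lemma invmx_sym n (M : 'M[R]_n) : M^T = M -> (invmx M)^T = invmx M.
Proof. by move=> sM; rewrite trmx_inv sM. Qed.

Lemma posdef_inv n (M : 'M[R]_n) : posdef M -> posdef (invmx M).
Proof.
move=> M0; have Mu := posdef_unit M0.
have := posdef_congr M0 (T := invmx M); rewrite unitmx_inv => /(_ Mu).
by rewrite invmx_sym ?posdef_sym // mulVmx // mul1mx.
Qed.

(** Crude stand-in for the operator norm: it dominates the quadratic form and tends to 0 along
    entrywise null sequences. *)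
Definition ent_sum m n (M : 'M[R]_(m, n)) : R := \sum_i \sum_j `|M i j|.

Lemma ent_sum_ge0 m n (M : 'M[R]_(m, n)) : 0 <= ent_sum M.
Proof. by apply: sumr_ge0 => i _; apply: sumr_ge0. Qed.

Lemma bf_ent_sum n (M : 'M[R]_n) x : `|bf M x x| <= ent_sum M * bf 1%:M x x.
Proof.
have -> : bf M x x = \sum_i \sum_j x i 0 * M i j * x j 0.
  rewrite /bf mxE exchange_big; apply: eq_bigr => j _; rewrite mxE mulr_suml.
  by apply: eq_bigr => i _; rewrite mxE.
rewrite /ent_sum mulr_suml; apply: le_trans (ler_norm_sum _ _ _) _.
apply: ler_sum => i _; rewrite mulr_suml; apply: le_trans (ler_norm_sum _ _ _) _.
apply: ler_sum => j _; rewrite !normrM -mulrA [X in X <= _]mulrCA.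
apply: ler_wpM2l => //.
have hx k : `|x k 0| ^+ 2 <= bf 1%:M x x.
  rewrite bf1E (bigD1 k) //= real_normK ?num_real // lerDl sumr_ge0 // => l _.
  by rewrite sqr_ge0.
by have := hx i; have := hx j; have := normr_ge0 (x i 0); have := normr_ge0 (x j 0); nra.
Qed.

Lemma bf_ub n (M : 'M[R]_n) x : bf M x x <= ent_sum M * bf 1%:M x x.
Proof. exact: le_trans (ler_norm _) (bf_ent_sum _ _). Qed.

(** Cauchy-Schwarz for [M] between [x] and [invmx M *m x] reads |x|^4 <= (x^T M x)(x^T M^-1 x), so
    an upper bound on the inverse is a lower bound on [M]. *)
Lemma posdef_lb n (M : 'M[R]_n) : posdef M ->
  exists2 e, 0 < e & forall x, e * bf 1%:M x x <= bf M x x.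
Proof.
move=> M0; have Mu := posdef_unit M0; have sM := posdef_sym M0.
pose c := ent_sum (invmx M) + 1.
have c0 : 0 < c by rewrite ltr_wpDl ?ent_sum_ge0.
exists c^-1; first by rewrite invr_gt0.
move=> x; rewrite mulrC ler_pdivrMr //.
have [->|x0] := eqVneq x 0; first by rewrite !bf0l mul0r.
have := psd_CauchySchwarz x (invmx M *m x) (posdef_psd M0).
rewrite -!bf_mulr !mulmxV //.
have -> : bf 1%:M (invmx M *m x) x = bf (invmx M) x x.
  by rewrite -[invmx M in RHS]mulmx1 bf_mull invmx_sym.
have := bf_ub (invmx M) x; have := bf1_gt0 x0; have := posdef_bf M0 x0.
rewrite /c; set a := bf 1%:M _ _; set b := bf M _ _; set d := bf (invmx M) _ _.
move=> b0 a0 h1 h2.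
have : a ^+ 2 <= b * ((ent_sum (invmx M) + 1) * a).
  by apply: le_trans h2 _; rewrite ler_pM2l //; nra.
by rewrite expr2 mulrA ler_pM2r.
Qed.

Lemma posdef_perturb n (M : 'M[R]_n) : posdef M ->
  exists2 e, 0 < e & forall E, E^T = E -> ent_sum E < e -> posdef (M + E).
Proof.
move=> M0; have [e e0 He] := posdef_lb M0; exists e => // E sE Ee.
split=> [|x x0]; first by rewrite /Defs.symmetric linearD /= sE posdef_sym.
rewrite -/(bf _ _ _) bfDm; have := He x; have := bf_ent_sum E x; have := bf1_gt0 x0.
rewrite ler_norml => a0 /andP[h _] h'; nra.
Qed.

Lemma ent_sumZ m n a (M : 'M[R]_(m, n)) : ent_sum (a *: M) = `|a| * ent_sum M.
Proof.
rewrite /ent_sum mulr_sumr; apply: eq_bigr => i _; rewrite mulr_sumr.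
by apply: eq_bigr => j _; rewrite mxE normrM.
Qed.

Lemma posdef_perturbZ n (M E : 'M[R]_n) : posdef M -> E^T = E ->
  exists2 e, 0 < e & forall a, `|a| < e -> posdef (M + a *: E).
Proof.
move=> M0 sE; have [e e0 He] := posdef_perturb M0.
have c0 : 0 < ent_sum E + 1 by rewrite ltr_wpDl ?ent_sum_ge0.
exists (e / (ent_sum E + 1)); first by rewrite divr_gt0.
move=> a; rewrite ltr_pdivlMr // => h; apply: He; first by rewrite linearZ /= sE.
by rewrite ent_sumZ; have := normr_ge0 a; nra.
Qed.

End BilinearForms.

(** Expansion leaves left-associated monomials whose entries are atoms; [ring] then only compares
    linear combinations of them. *)
Ltac mxnormalize := rewrite ?(mulmxDl, mulmxDr, mulmxBl, mulmxBr, mulNmx, mulmxN,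
  scalerA, opprK, scalerDr, scalerN, scalerBr, =^~ scalemxAl, =^~ scalemxAr, mulmxA).
Ltac mxentry := rewrite ?(addmxE, oppmxE, scalemxE, zeromxE).
Ltac mxring := mxnormalize; apply/matrixP => ? ?; mxentry; ring.

(** * Hurwitz matrices, Sylvester and Lyapunov equations *)

Section Hurwitz.
Variable R : realType.
Implicit Types (m n : nat).

Lemma eigenvalueE (F : fieldType) n (M : 'M[F]_n) a :
  eigenvalue M a = (M - a%:M \notin unitmx).
Proof. by rewrite /eigenvalue /eigenspace kermx_eq0 row_free_unit. Qed.

Lemma MtoC_tr m n (M : 'M[R]_(m, n)) : MtoC M^T = (MtoC M)^T.
Proof. by rewrite /MtoC map_trmx. Qed.

Lemma hurwitz_tr n (M : 'M[R]_n) : hurwitz M -> hurwitz M^T.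
Proof.
move=> hM a; rewrite eigenvalueE MtoC_tr -unitmx_tr linearB /= trmxK tr_scalar_mx.
by rewrite -eigenvalueE; apply: hM.
Qed.

Definition cmx m n (u v : 'M[R]_(m, n)) : 'M[R[i]]_(m, n) :=
  \matrix_(i, j) (u i j +i* v i j)%C.

Lemma sum_complex (I : finType) (f g : I -> R) :
  \sum_i (f i +i* g i)%C = ((\sum_i f i) +i* (\sum_i g i))%C.
Proof.
elim/big_rec3: _ => [|i a b c _ ->]; first by [].
by [].
Qed.

Lemma cmx_mull m n p (M : 'M[R]_(m, n)) (u v : 'M[R]_(n, p)) :
  MtoC M *m cmx u v = cmx (M *m u) (M *m v).
Proof.
apply/matrixP => i j; rewrite !mxE -sum_complex; apply: eq_bigr => k _.
by rewrite !mxE /toC /=; apply/eqP; rewrite eq_complex /= !mul0r subr0 addr0 !eqxx.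
Qed.

Lemma cmx_mulr m n p (M : 'M[R]_(n, p)) (u v : 'M[R]_(m, n)) :
  cmx u v *m MtoC M = cmx (u *m M) (v *m M).
Proof.
apply/matrixP => i j; rewrite !mxE -sum_complex; apply: eq_bigr => k _.
rewrite !mxE /toC /=; apply/eqP.
by rewrite eq_complex /= !mulr0 subr0 add0r !eqxx.
Qed.

Lemma cmx_scale m n a b (u v : 'M[R]_(m, n)) :
  (a +i* b)%C *: cmx u v = cmx (a *: u - b *: v) (b *: u + a *: v).
Proof.
apply/matrixP => i j; rewrite !mxE; apply/eqP.
by rewrite eq_complex /= eqxx addrC eqxx.
Qed.

Lemma cmxD m n (u v u' v' : 'M[R]_(m, n)) : cmx u v + cmx u' v' = cmx (u + u') (v + v').
Proof. by apply/matrixP => i j; rewrite !mxE. Qed.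

Lemma cmxN m n (u v : 'M[R]_(m, n)) : - cmx u v = cmx (- u) (- v).
Proof. by apply/matrixP => i j; rewrite !mxE. Qed.

Lemma cmx_surj m n (z : 'M[R[i]]_(m, n)) : exists u v, z = cmx u v.
Proof.
exists (map_mx (@complex.Re R) z), (map_mx (@complex.Im R) z).
by apply/matrixP => i j; rewrite !mxE; case: (z i j).
Qed.

Lemma cmx_inj m n (u v u' v' : 'M[R]_(m, n)) : cmx u v = cmx u' v' -> u = u' /\ v = v'.
Proof.
move=> /matrixP e; split; apply/matrixP => i j; have := e i j; rewrite !mxE;
by case.
Qed.

Lemma cmx_eq0 m n (u v : 'M[R]_(m, n)) : (cmx u v == 0) = (u == 0) && (v == 0).
Proof.
have c0 : cmx 0 0 = 0 :> 'M[R[i]]_(m, n) by apply/matrixP => i j; rewrite !mxE.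
apply/eqP/andP => [|[/eqP-> /eqP->]//]; rewrite -c0 => /cmx_inj[-> ->].
by rewrite !eqxx.
Qed.

(** Real form of an eigenvector u + i v for the eigenvalue a + i b. [eigenvalue] speaks of row
    vectors, hence the passage to the transpose. *)
Lemma hurwitz_re n (M : 'M[R]_n) : hurwitz M -> forall a b (u v : 'cV[R]_n),
  M *m u = a *: u - b *: v -> M *m v = b *: u + a *: v -> (u != 0) || (v != 0) -> a < 0.
Proof.
move=> /hurwitz_tr hM a b u v Mu Mv uv0.
apply: (hM (a +i* b)%C); apply/eigenvalueP.
exists (cmx u^T v^T); last by rewrite cmx_eq0 !trmx_eq0 negb_and.
by rewrite cmx_mulr cmx_scale -!trmx_mul Mu Mv !linearD !linearN !linearZ.
Qed.

Lemma not_hurwitz n (M : 'M[R]_n) : ~ hurwitz M -> exists a b (u v : 'cV[R]_n),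
  [/\ 0 <= a, M *m u = a *: u - b *: v, M *m v = b *: u + a *: v & (u != 0) || (v != 0)].
Proof.
move=> nM; have : ~ hurwitz M^T by move/hurwitz_tr; rewrite trmxK.
move=> /existsNP[[a b]] /not_implyP[/eigenvalueP[z]].
have [u [v ->]] := cmx_surj z; rewrite cmx_mulr cmx_scale => /cmx_inj[Mu Mv].
rewrite cmx_eq0 negb_and /= => uv0 /negP; rewrite -leNgt => a0.
exists a, b, u^T, v^T; split=> //; last by rewrite !trmx_eq0.
  by rewrite -[M]trmxK -trmx_mul Mu linearB !linearZ.
by rewrite -[M]trmxK -trmx_mul Mv linearD !linearZ.
Qed.

Lemma hurwitz_sim n (T M : 'M[R]_n) :
  T \in unitmx -> hurwitz M -> hurwitz (T *m M *m invmx T).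
Proof.
move=> Tu hM; apply: contrapT => /not_hurwitz[a [b [u [v [a0 Mu Mv uv0]]]]].
have inv0 x : x != 0 -> invmx T *m x != 0.
  by apply: contra_neq => h; rewrite -(mulKVmx Tu x) h mulmx0.
have := hurwitz_re hM (a := a) (b := b) (u := invmx T *m u) (v := invmx T *m v).
rewrite ltNge a0 => H; suff : ~~ true by []; apply: H.
- by rewrite !scalemxAr -mulmxBr -Mu !mulmxA mulVmx // mul1mx.
- by rewrite !scalemxAr -mulmxDr -Mv !mulmxA mulVmx // mul1mx.
- by case/orP: uv0 => /inv0 ->; rewrite ?orbT.
Qed.

Lemma horner_mx_intertwine (F : fieldType) n (M N D : 'M[F]_n.+1) (p : {poly F}) :
  M *m D = D *m N -> horner_mx M p *m D = D *m horner_mx N p.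
Proof.
move=> e; elim/poly_ind: p => [|p c IH]; first by rewrite !rmorph0 mul0mx mulmx0.
rewrite !rmorphD !rmorphM /= !horner_mx_X !horner_mx_C mulmxDl mulmxDr.
by rewrite -[_ * M]/(_ *m M) -[_ * N]/(_ *m N) -mulmxA e !mulmxA IH mul_scalar_mx mul_mx_scalar.
Qed.

(** [D] intertwines [H1] with [- H2], so by Cayley-Hamilton the characteristic polynomial of [H1]
    evaluated at [- H2] annihilates [D]. That matrix is a product of invertible factors, because the
    spectra of [H1] and [- H2] lie in opposite half-planes. *)
Lemma sylvester_inj n (H1 H2 D : 'M[R]_n) :
  hurwitz H1 -> hurwitz H2 -> H1 *m D + D *m H2 = 0 -> D = 0.
Proof.
case: n H1 H2 D => [|n] H1 H2 D h1 h2; first by move=> _; apply: flatmx0.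
move=> e.
have eC : MtoC H1 *m MtoC D = MtoC D *m - MtoC H2.
  rewrite mulmxN -[MtoC H1]/(map_mx (real_complex R) H1).
  rewrite -[MtoC H2]/(map_mx (real_complex R) H2) -[MtoC D]/(map_mx (real_complex R) D).
  by rewrite -!map_mxM -map_mxN; congr map_mx; apply/eqP; rewrite -addr_eq0 e.
have := horner_mx_intertwine (char_poly (MtoC H1)) eC.
rewrite Cayley_Hamilton mul0mx => /esym DP.
have [r Pr] := closed_field_poly_normal (char_poly (MtoC H1)).
have U : horner_mx (- MtoC H2) (char_poly (MtoC H1)) \in unitmx.
  have rP z : z \in r -> root (char_poly (MtoC H1)) z.
    move=> zr; rewrite Pr (monicP (char_poly_monic _)) scale1r.
    by rewrite root_prod_XsubC.
  rewrite Pr (monicP (char_poly_monic _)) scale1r rmorph_prod.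
  have: {in r, forall z, horner_mx (- MtoC H2) ('X - z%:P) \in unitmx}.
    move=> z /rP; rewrite -eigenvalue_root_char => /h1 z0.
    rewrite rmorphB /= horner_mx_X horner_mx_C -opprD -scaleN1r unitmxZ ?unitrN1 //.
    apply: contraT => nu.
    have : eigenvalue (MtoC H2) (- z) by rewrite eigenvalueE raddfN opprK.
    by move/h2; case: z z0 {nu} => a b /=; lra.
  elim: r {rP Pr} => [|z r IH] H; first by rewrite big_nil unitmx1.
  rewrite big_cons unitmx_mul H ?mem_head //= IH // => y yr.
  by rewrite H // inE yr orbT.
have : MtoC D = 0 by rewrite -(mulmxK U (MtoC D)) DP mul0mx.
move=> /matrixP D0; apply/matrixP => i j.
by have := D0 i j; rewrite !mxE => -[].
Qed.

Definition lyap n (H P : 'M[R]_n) : 'M[R]_n := H^T *m P + P *m H.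

Lemma bf_lyap n (H P : 'M[R]_n) x : P^T = P -> bf (lyap H P) x x = bf P x (H *m x) *+ 2.
Proof. by move=> sP; rewrite bfDm bf_mull trmxK bf_mulr bf_sym // mulr2n. Qed.

Lemma lyapB n (H P P' : 'M[R]_n) : lyap H (P - P') = lyap H P - lyap H P'.
Proof. by rewrite /lyap mulmxBr mulmxBl opprD addrACA. Qed.

Lemma lyapD n (H P P' : 'M[R]_n) : lyap H (P + P') = lyap H P + lyap H P'.
Proof. by rewrite /lyap mulmxDr mulmxDl addrACA. Qed.

Lemma lyapZ n a (H P : 'M[R]_n) : lyap H (a *: P) = a *: lyap H P.
Proof. by rewrite /lyap -scalemxAr -scalemxAl scalerDr. Qed.

Lemma lyapN n (H P : 'M[R]_n) : lyap H (- P) = - lyap H P.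
Proof. by rewrite -scaleN1r lyapZ scaleN1r. Qed.

Lemma lyapNl n (H P : 'M[R]_n) : lyap (- H) P = - lyap H P.
Proof. by rewrite /lyap linearN /= mulNmx mulmxN opprD. Qed.

Lemma lyapDl n (H H' P : 'M[R]_n) : lyap (H + H') P = lyap H P + lyap H' P.
Proof. by rewrite /lyap linearD /= mulmxDl mulmxDr addrACA. Qed.

Lemma lyap_tr n (H P : 'M[R]_n) : (lyap H P)^T = lyap H P^T.
Proof. by rewrite /lyap linearD /= !trmx_mul trmxK addrC. Qed.

Lemma lyap_inj n (H D : 'M[R]_n) : hurwitz H -> lyap H D = 0 -> D = 0.
Proof. by move=> hH; exact: (sylvester_inj (hurwitz_tr hH) hH). Qed.

Definition lyap_lin n (H : 'M[R]_n) : 'M[R]_(n * n, n * n) :=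
  lin_mx (mulmx H^T) + lin_mx (mulmxr H).

Lemma lyap_linE n (H D : 'M[R]_n) : mxvec D *m lyap_lin H = mxvec (lyap H D).
Proof. by rewrite /lyap_lin mulmxDr !mul_vec_lin /= /lyap linearD. Qed.

(** Inverting the operator on vectorised matrices makes the solution visibly linear in [C], which
    later bounds it to any order in a perturbation. *)
Definition lyap_sol n (H C : 'M[R]_n) : 'M[R]_n := vec_mx (mxvec C *m invmx (lyap_lin H)).

Lemma lyap_solP n (H C : 'M[R]_n) : hurwitz H -> lyap H (lyap_sol H C) = C.
Proof.
move=> hH; have U : lyap_lin H \in unitmx.
  rewrite -row_free_unit -kermx_eq0; apply/eqP/row_matrixP => i; rewrite row0.
  have := mulmx_ker (lyap_lin H) => /(congr1 (row i)); rewrite row_mul row0.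
  rewrite -[row i _ in X in X -> _]vec_mxK lyap_linE => h.
  have : lyap H (vec_mx (row i (kermx (lyap_lin H)))) = 0.
    by apply: (can_inj mxvecK); rewrite h linear0.
  by move/(lyap_inj hH)/(congr1 mxvec); rewrite vec_mxK linear0.
apply: (can_inj mxvecK); rewrite -lyap_linE /lyap_sol vec_mxK.
by rewrite mulmxKV.
Qed.

Lemma lyap_sol_sym n (H C : 'M[R]_n) : hurwitz H -> C^T = C -> (lyap_sol H C)^T = lyap_sol H C.
Proof.
move=> hH sC; apply/eqP; rewrite -subr_eq0; apply/eqP; apply: (lyap_inj hH).
by rewrite lyapB -lyap_tr lyap_solP // sC subrr.
Qed.

(** A strictly decreasing quadratic Lyapunov function. *)
Definition certified n (H : 'M[R]_n) :=
  exists2 P : 'M[R]_n, posdef P & posdef (- lyap H P).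

Lemma certified_hurwitz n (H : 'M[R]_n) : certified H -> hurwitz H.
Proof.
move=> [P P0 LP]; apply: contrapT => /not_hurwitz[a [b [u [v [a0 Hu Hv uv0]]]]].
have sP := posdef_sym P0.
(* Adding the forms at the real and imaginary parts cancels the cross terms in [b]. *)
have e : bf (- lyap H P) u u + bf (- lyap H P) v v = - a * (bf P u u + bf P v v) *+ 2.
  rewrite !bfNm !bf_lyap // Hu Hv !(bfDr, bfNr, bfZr) (bf_sym v u sP); ring.
have : 0 < bf (- lyap H P) u u + bf (- lyap H P) v v.
  case/orP: uv0 => [/(posdef_bf LP)|/(posdef_bf LP)] h.
    by rewrite ltr_pwDl // psd_bf //; apply: posdef_psd.
  by rewrite ltr_wpDl // psd_bf //; apply: posdef_psd.
have := psd_bf u (posdef_psd P0); have := psd_bf v (posdef_psd P0).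
by rewrite e; nra.
Qed.

(** At a kernel vector x of [D] the form of [lyap H D] is 2 x^T D H x = 0. *)
Lemma lyap_kernel n (H D : 'M[R]_n) : possemidef D -> posdef (- lyap H D) -> posdef D.
Proof.
move=> D0 L; have sD := psd_sym D0; split=> // x x0.
rewrite -/(bf D x x) lt_def psd_bf // andbT; apply/eqP => Dx.
have := posdef_bf L x0; rewrite bfNm bf_lyap // -[D]mulmx1 bf_mull sD (psd_ker D0 Dx).
by rewrite bf0l mul0rn oppr0 ltxx.
Qed.

(* Along the segment P + t D the first loss of definiteness would produce a
   kernel vector of a semidefinite matrix whose Lyapunov image is definite. *)
Lemma certified_lyap_psd n (H D : 'M[R]_n) : certified H -> D^T = D ->
  possemidef (- lyap H D) -> possemidef D.
Proof.
move=> [P P0 LP] sD LD; split=> // x; rewrite leNgt; apply/negP => Dx.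
rewrite -/(bf D x x) in Dx.
pose E := [set t : R | 0 <= t /\ posdef (P + t *: D)]%classic.
have sPD t : (P + t *: D)^T = P + t *: D by rewrite linearD linearZ /= sD posdef_sym.
have E0 : E 0 by split; rewrite // scale0r addr0.
have x0 : x != 0 by apply: contraTneq Dx => ->; rewrite bf0r ltxx.
have ubE : ubound E (- bf P x x / bf D x x).
  move=> t [t0 /posdef_bf/(_ x0)]; rewrite bfDm bfZm => h.
  rewrite ler_ndivlMr //; lra.
have supE : has_sup E by split; [exists 0 | exists (- bf P x x / bf D x x)].
set s := sup E; have s0 : 0 <= s by apply: sup_upper_bound.
have Ps : possemidef (P + s *: D).
  split=> // y; rewrite leNgt -/(bf (P + s *: D) y y); apply/negP => neg.
  rewrite bfDm bfZm in neg.
  have y0 : y != 0 by apply: contraTneq neg => ->; rewrite !bf0r mulr0 addr0 ltxx.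
  have Py := posdef_bf P0 y0.
  have Dy : bf D y y < 0 by nra.
  have : s <= - bf P y y / bf D y y.
    apply: sup_le_ub; [by exists 0 | move=> t [t0 /posdef_bf/(_ y0)]].
    by rewrite bfDm bfZm => h; rewrite ler_ndivlMr //; lra.
  by rewrite ler_ndivlMr //; lra.
have LPs : posdef (- lyap H (P + s *: D)).
  rewrite lyapD lyapZ opprD -scalerN; apply: posdef_psdD => //; exact: psdZ.
have Ps0 := lyap_kernel Ps LPs.
have [e e0 He] := posdef_perturbZ Ps0 sD.
have : E (s + e / 2).
  split; first lra; rewrite scalerDl addrA; apply: He.
  by rewrite gtr0_norm; lra.
by move/(sup_upper_bound supE); rewrite -/s; lra.
Qed.

Lemma lyap_shift n (H P : 'M[R]_n) s : lyap (H - s%:M) P = lyap H P - (s *+ 2) *: P.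
Proof.
rewrite /lyap linearB /= tr_scalar_mx mulmxBl mulmxBr mul_scalar_mx mul_mx_scalar.
by apply/matrixP => i j; mxentry; ring.
Qed.

Lemma hurwitz_shift n (H : 'M[R]_n) s : 0 <= s -> hurwitz H -> hurwitz (H - s%:M).
Proof.
move=> s0 hH; apply: contrapT => /not_hurwitz[a [b [u [v [a0 Hu Hv uv0]]]]].
have : a + s < 0; last by lra.
apply: (hurwitz_re hH (b := b) (u := u) (v := v)) => //.
  move: Hu; rewrite mulmxBl mul_scalar_mx => /eqP; rewrite subr_eq => /eqP ->.
  by rewrite scalerDl addrAC.
move: Hv; rewrite mulmxBl mul_scalar_mx => /eqP; rewrite subr_eq => /eqP ->.
by rewrite scalerDl addrA.
Qed.

(* The shifts s for which H - s is certified form an open up-set; at its infimum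
   the Lyapunov equation is still uniquely solvable, and its solution is a certificate. *)
Lemma hurwitz_certified n (H : 'M[R]_n) : hurwitz H -> certified H.
Proof.
move=> hH.
pose E := [set s : R | 0 <= s /\ certified (H - s%:M)]%classic.
(* At this shift the identity is a certificate, since twice the shift dominates the form of
   [H^T + H]. *)
have E1 : E (ent_sum (H^T + H) + 1).
  have c0 := ent_sum_ge0 (H^T + H).
  split; first lra.
  exists 1%:M; first exact: posdef1.
  split; first by rewrite /Defs.symmetric linearN /= lyap_tr trmx1.
  move=> x x0; rewrite -/(bf _ _ _) lyap_shift bfNm bfDm bfNm bfZm.
  rewrite /lyap mulmx1 mul1mx; have := bf_ub (H^T + H) x; have := bf1_gt0 x0; nra.
have lbE : lbound E 0 by move=> s [].
have infE : has_inf E by split; [exists (ent_sum (H^T + H) + 1) | exists 0].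
set s := inf E.
have s0 : 0 <= s by apply: lb_le_inf => //; exists (ent_sum (H^T + H) + 1).
have hs := hurwitz_shift s0 hH.
have s1 : (1%:M : 'M[R]_n)^T = 1%:M by exact: trmx1.
pose D := lyap_sol (H - s%:M) (- 1%:M).
have LD : lyap (H - s%:M) D = - 1%:M by apply: lyap_solP.
have sD : D^T = D by apply: lyap_sol_sym => //; rewrite linearN /= s1.
have shD t : - lyap (H - (s + t)%:M) D = 1%:M + (t *+ 2) *: D.
  move: LD; rewrite !lyap_shift => /matrixP LD; apply/matrixP => i j.
  by have := LD i j; mxentry => h; lra.
have [e e0 He] := posdef_perturbZ (posdef1 R n) sD.
have [t [[t0 ct] ts]] : exists t, E t /\ t < s + e / 4.
  by have [t Et ts] := inf_adherent (ltac:(lra) : 0 < e / 4) infE; exists t.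
have st : s <= t by exact: (@ge_inf _ E (ex_intro _ 0 lbE) t (conj t0 ct)).
(* Seen from a certified shift [t] just above the infimum, [D] solves a Lyapunov equation whose
   right side is still close to the identity. *)
have D0 : possemidef D.
  apply: (certified_lyap_psd ct sD); have -> : t = s + (t - s) by lra.
  rewrite shD; apply/posdef_psd/He; rewrite ger0_norm; lra.
have Dp : posdef D by apply: (lyap_kernel (H := H - s%:M)) => //; rewrite LD opprK; exact: posdef1.
have cs r : `|r| < e / 2 -> certified (H - (s + r)%:M).
  by move=> hr; exists D => //; rewrite shD; apply: He; rewrite normrMn; lra.
have [s00|sp] := eqVneq s 0.
  have := cs 0; rewrite s00 addr0 raddf0 subr0; apply; rewrite normr0; lra.
have {sp s0}s0 : 0 < s by rewrite lt_def sp.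
(* If the infimum were positive, [D] would certify a slightly smaller shift as well. *)
have [r [r0 re rs]] : exists r, [/\ 0 < r, r < e / 2 & r <= s].
  exists (Num.min (e / 4) s); rewrite lt_min s0 gt_min ge_min lexx orbT; split=> //; first lra.
  by apply/orP; left; lra.
have : E (s - r) by split; [lra | apply: cs; rewrite normrN gtr0_norm].
by move/(ge_inf (ex_intro _ 0 lbE)); rewrite -/s; lra.
Qed.

Lemma lyap_psd n (H D : 'M[R]_n) : hurwitz H -> D^T = D ->
  possemidef (- lyap H D) -> possemidef D.
Proof. by move=> /hurwitz_certified; apply: certified_lyap_psd. Qed.

Lemma lyap_posdef n (H D : 'M[R]_n) : hurwitz H -> D^T = D ->
  posdef (- lyap H D) -> posdef D.
Proof.
move=> hH sD L; apply: (lyap_kernel (H := H)) => //.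
by apply: (lyap_psd hH) => //; apply: posdef_psd.
Qed.

End Hurwitz.

(** * Entrywise limits of matrix sequences *)

Section MatrixLimits.
Variable R : realType.
Implicit Types (m n : nat).
Local Open Scope classical_set_scope.

Definition mcvg m n (u : nat -> 'M[R]_(m, n)) (L : 'M[R]_(m, n)) :=
  forall i j, (fun k => u k i j) @ \oo --> L i j.

Lemma mcvg_cst m n (L : 'M[R]_(m, n)) : mcvg (fun _ => L) L.
Proof. by move=> i j; apply: cvg_cst. Qed.

Lemma mcvgD m n (u v : nat -> 'M[R]_(m, n)) L M :
  mcvg u L -> mcvg v M -> mcvg (fun k => u k + v k) (L + M).
Proof.
move=> uL vM i j; rewrite mxE.
under eq_fun do rewrite mxE.
by apply: cvgD.
Qed.

Lemma mcvgN m n (u : nat -> 'M[R]_(m, n)) L : mcvg u L -> mcvg (fun k => - u k) (- L).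
Proof.
move=> uL i j; rewrite mxE.
under eq_fun do rewrite mxE.
by apply: cvgN.
Qed.

Lemma cvg_sumr (I : Type) (r : seq I) (f : I -> nat -> R) (l : I -> R) :
  (forall i, f i @ \oo --> l i) -> (fun k => \sum_(i <- r) f i k) @ \oo --> \sum_(i <- r) l i.
Proof.
move=> fl; elim: r => [|i r IH].
  by rewrite big_nil; under eq_fun do rewrite big_nil; apply: cvg_cst.
rewrite big_cons; under eq_fun do rewrite big_cons.
by apply: cvgD.
Qed.

Lemma mcvgM m n p (u : nat -> 'M[R]_(m, n)) (v : nat -> 'M[R]_(n, p)) L M :
  mcvg u L -> mcvg v M -> mcvg (fun k => u k *m v k) (L *m M).
Proof.
move=> uL vM i j; rewrite mxE.
under eq_fun do rewrite mxE.
by apply: cvg_sumr => k; apply: cvgM.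
Qed.

Lemma mcvg_shift m n (u : nat -> 'M[R]_(m, n)) L : mcvg u L -> mcvg (fun k => u k.+1) L.
Proof. by move=> uL i j; have := uL i j; rewrite -cvg_shiftS. Qed.

Lemma mcvg_unique m n (u : nat -> 'M[R]_(m, n)) L M : mcvg u L -> mcvg u M -> L = M.
Proof.
move=> uL uM; apply/matrixP => i j; have := uL i j; have := uM i j.
by move=> h1 h2; apply: (cvg_unique _ h2 h1).
Qed.

Lemma mcvg_bf m n (u : nat -> 'M[R]_(m, n)) L x y :
  mcvg u L -> (fun k => bf (u k) x y) @ \oo --> bf L x y.
Proof.
move=> uL; have : mcvg (fun k => x^T *m u k *m y) (x^T *m L *m y).
  by apply: mcvgM; [apply: mcvgM => //|]; apply: mcvg_cst.
exact.
Qed.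

Lemma mcvg_tr m n (u : nat -> 'M[R]_(m, n)) L : mcvg u L -> mcvg (fun k => (u k)^T) L^T.
Proof. by move=> uL i j; rewrite mxE; under eq_fun do rewrite mxE; apply: uL. Qed.

Lemma mcvg_psd n (u : nat -> 'M[R]_n) L :
  mcvg u L -> (forall k, possemidef (u k)) -> possemidef L.
Proof.
move=> uL u0; split.
  apply: (mcvg_unique (mcvg_tr uL)).
  by under eq_fun do rewrite (psd_sym (u0 _)).
move=> x; have h := mcvg_bf (x := x) (y := x) uL.
rewrite -/(bf L x x) -(cvg_lim _ h) //; apply: limr_ge.
  by apply/cvg_ex; exists (bf L x x).
by near=> k; apply: psd_bf.
Unshelve. all: by end_near.
Qed.

(** Each quadratic form is a monotone bounded real sequence; polarisation on basis vectors recovers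
    the entries from these limits. *)
Lemma mcvg_monotone n (u : nat -> 'M[R]_n) (L : 'M[R]_n) :
  (forall k, (u k)^T = u k) -> (forall k, possemidef (u k - u k.+1)) ->
  (forall k, possemidef (u k - L)) -> exists M, mcvg u M.
Proof.
move=> us um ul.
have cv x : exists l : R, (fun k => bf (u k) x x) @ \oo --> l.
  apply/cvg_ex; apply: nonincreasing_is_cvgn.
    apply/nonincreasing_seqP => k; have := psd_bf x (um k).
    by rewrite bfDm bfNm subr_ge0.
  exists (bf L x x) => _ [k _ <-]; have := psd_bf x (ul k).
  by rewrite bfDm bfNm subr_ge0.
have [l hl] := choice cv.
pose e (i : 'I_n) : 'cV[R]_n := delta_mx i 0.
exists (\matrix_(i, j) ((l (e i + e j) - l (e i) - l (e j)) / 2)) => i j.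
rewrite mxE.
have -> : (fun k => u k i j) =
  (fun k => (bf (u k) (e i + e j) (e i + e j) - bf (u k) (e i) (e i) - bf (u k) (e j) (e j)) / 2).
  apply/funext => k; rewrite !(bfDl, bfDr) (bf_sym (e j) (e i)) //.
  by rewrite -(bf_delta (u k) i j) -/(e i) -/(e j); field.
apply: cvgM; last exact: cvg_cst.
by apply: cvgB; [apply: cvgB|]; apply: hl.
Qed.

End MatrixLimits.

(** * Riccati equations with a definite quadratic term *)

Section Riccati.
Variables (R : realType) (n : nat) (A W S : 'M[R]_n).
Hypotheses (W0 : posdef W) (sS : S^T = S).
Implicit Types N M : 'M[R]_n.

Definition ric N : 'M[R]_n := N *m A + A^T *m N + N *m W *m N + S.

Let sW : W^T = W := posdef_sym W0.

(** Exact second-order expansion of [ric] at [N]: the closed-loop Lyapunov operator is the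
    derivative, and the last term is the convex quadratic part. *)
Lemma ric_lyap N M : N^T = N ->
  lyap (A + W *m N) M = ric M - S + N *m W *m N - (M - N) *m W *m (M - N).
Proof. by move=> sN; rewrite /lyap /ric linearD /= trmx_mul sN sW; mxring. Qed.

Lemma ric_lyapB N M : N^T = N ->
  lyap (A + W *m N) (N - M) = ric N - ric M + (M - N) *m W *m (M - N).
Proof. by move=> sN; rewrite lyapB !ric_lyap // subrr mulmx0; mxring. Qed.

Lemma psd_sandwich N : N^T = N -> possemidef (N *m W *m N).
Proof. by move=> sN; rewrite -{1}sN; apply: psd_congr; apply: posdef_psd. Qed.

(** By convexity [lyap (A + W *m N) (N - M)] is semidefinite, and antistability turns this into an
    order: an antistable solution lies above every subsolution. *)
Lemma ric_max N M : N^T = N -> M^T = M -> hurwitz (- (A + W *m N)) ->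
  possemidef (ric N - ric M) -> possemidef (N - M).
Proof.
move=> sN sM hN L; apply: (lyap_psd hN); first by rewrite linearB /= sN sM.
rewrite lyapNl opprK ric_lyapB //; apply: psdD => //.
by apply: psd_sandwich; rewrite linearB /= sN sM.
Qed.

(** The gap [N - M] is itself the certificate of antistability. *)
Lemma ric_antistable N M : N^T = N -> M^T = M -> posdef (- ric M) -> possemidef (ric N) ->
  possemidef (N - M) -> hurwitz (- (A + W *m N)) /\ posdef (N - M).
Proof.
move=> sN sM M0 N0 NM.
have L : posdef (- lyap (- (A + W *m N)) (N - M)).
  rewrite lyapNl opprK ric_lyapB //; apply: posdef_psdD.
    exact: psd_posdefD.
  by apply: psd_sandwich; rewrite linearB /= sN sM.
have NM0 := lyap_kernel NM L.
by split=> //; apply: certified_hurwitz; exists (N - M).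
Qed.

(** Along [E] the value of [ric] decreases at first order by a multiple of the identity, which beats
    the quadratic term for a small step. *)
Lemma ric_solve_strict N E : N^T = N -> ric N = 0 -> E^T = E ->
  lyap (A + W *m N) E = - 1%:M ->
  exists2 M, M^T = M & posdef (- ric M).
Proof.
move=> sN N0 sE LE.
have sEWE : (- (E *m W *m E))^T = - (E *m W *m E).
  by rewrite linearN /= !trmx_mul sE sW mulmxA.
have [e e0 He] := posdef_perturbZ (posdef1 R n) sEWE.
exists (N + (e / 2) *: E); first by rewrite linearD linearZ /= sN sE.
have -> : - ric (N + (e / 2) *: E) = (e / 2) *: (1%:M + (e / 2) *: - (E *m W *m E)).
  have -> : 1%:M = - lyap (A + W *m N) E by rewrite LE opprK.
  rewrite -[RHS]add0r -oppr0 -[in RHS]N0.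
  by rewrite /ric /lyap [(A + _)^T]linearD /= trmx_mul sN sW; mxring.
by apply: posdefZ; [lra | apply: He; rewrite gtr0_norm; lra].
Qed.

(* One step of Newton's (Kleinman's) iteration for ric N = 0. *)
Lemma newton_step M N : M^T = M -> posdef (- ric M) ->
  N^T = N -> hurwitz (- (A + W *m N)) ->
  exists N', [/\ N'^T = N' /\ hurwitz (- (A + W *m N')), possemidef (ric N'), possemidef (N' - M),
    lyap (A + W *m N) N' = N *m W *m N - S & possemidef (ric N) -> possemidef (N - N')].
Proof.
move=> sM M0 sN hN.
pose N' := lyap_sol (- (A + W *m N)) (S - N *m W *m N).
have LN' : lyap (A + W *m N) N' = N *m W *m N - S.
  apply: oppr_inj; rewrite -lyapNl lyap_solP // opprB //.
have sN' : N'^T = N'.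
  by apply: lyap_sol_sym => //; rewrite linearB /= !trmx_mul sN sW sS mulmxA.
have sNM : (N - M)^T = N - M by rewrite linearB /= sN sM.
have sNN' : (N - N')^T = N - N' by rewrite linearB /= sN sN'.
have NM : possemidef (N' - M).
  apply: (lyap_psd hN); first by rewrite linearB /= sN' sM.
  rewrite lyapNl opprK lyapB LN' ric_lyap //.
  have -> : N *m W *m N - S - (ric M - S + N *m W *m N - (M - N) *m W *m (M - N)) =
    - ric M + (N - M) *m W *m (N - M) by mxring.
  by apply: psdD; [apply: posdef_psd | apply: psd_sandwich].
(* The Newton residual is exactly the quadratic error, hence semidefinite whatever the sign of
   [ric N]; this allows an arbitrary antistable start. *)
have rN' : ric N' = (N - N') *m W *m (N - N').
  have := ric_lyap N' sN; rewrite LN' => /matrixP h; apply/matrixP => i j; have := h i j.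
  by mxnormalize; mxentry => h'; lra.
have N'0 : possemidef (ric N') by rewrite rN'; apply: psd_sandwich.
have [hN' _] := ric_antistable sN' sM M0 N'0 NM.
exists N'; split=> // N0; apply: (lyap_psd hN) => //.
rewrite lyapNl opprK lyapB LN' ric_lyap // subrr mulmx0 subr0.
by have -> : ric N - S + N *m W *m N - (N *m W *m N - S) = ric N by mxring.
Qed.

(** A multiple of [invmx W] makes [W *m N] a large multiple of the identity, which swamps [A]. *)
Lemma antistable_start : exists2 N, N^T = N & hurwitz (- (A + W *m N)).
Proof.
have c0 := ent_sum_ge0 (A^T + A).
exists ((ent_sum (A^T + A) + 1) *: invmx W).
  by rewrite linearZ /= invmx_sym.
rewrite -scalemxAr mulmxV ?posdef_unit //; apply: certified_hurwitz.
exists 1%:M; first exact: posdef1.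
split; first by rewrite /Defs.symmetric linearN /= lyap_tr trmx1.
move=> x x0; rewrite -/(bf _ _ _) lyapNl opprK.
have -> : lyap (A + (ent_sum (A^T + A) + 1) *: 1%:M) 1%:M =
  (A^T + A) + ((ent_sum (A^T + A) + 1) *+ 2) *: 1%:M.
  rewrite /lyap linearD linearZ /= trmx1 mulmx1 mul1mx; mxring.
rewrite bfDm bfZm; have := bf_ent_sum (A^T + A) x; have := bf1_gt0 x0.
by rewrite ler_norml => ? /andP[? ?]; nra.
Qed.

Theorem riccati_solution M : M^T = M -> posdef (- ric M) ->
  exists N, [/\ N^T = N, ric N = 0, hurwitz (- (A + W *m N)) & posdef (N - M)].
Proof.
move=> sM M0.
pose good N := [/\ N^T = N, hurwitz (- (A + W *m N)) & possemidef (ric N)].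
have step N : exists N', good N -> [/\ good N', possemidef (N' - M),
    lyap (A + W *m N) N' = N *m W *m N - S & possemidef (N - N')].
  have [[sN hN N0]|nN] := pselect (good N); last by exists N.
  have [N' [[? ?] ? ? ? h]] := newton_step sM M0 sN hN.
  by exists N' => _; split=> //; exact: h.
have [f Hf] := choice step.
(* The start need not satisfy [ric N00 >= 0]; one Newton step enforces it, and the sequence
   decreases from there on. *)
have [N00 sN00 hN00] := antistable_start.
have [N0 [[sN0 hN0] rN0 N0M _ _]] := newton_step sM M0 sN00 hN00.
pose u k := iter k f N0.
have u_good k : good (u k) by elim: k => [|k /Hf[]//]; split.
have uM k : possemidef (u k - M) by case: k => [//|k]; have [] := Hf _ (u_good k).
have umon k : possemidef (u k - u k.+1) by have [] := Hf _ (u_good k).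
have usym k : (u k)^T = u k by have [] := u_good k.
have [N uN] := mcvg_monotone usym umon uM.
have sN : N^T = N.
  by apply: (mcvg_unique (mcvg_tr uN)); under eq_fun do rewrite usym.
have NM : possemidef (N - M).
  by apply: (mcvg_psd (u := fun k => u k - M)) => //; apply: mcvgD => //; apply: mcvgN; apply: mcvg_cst.
have rN : ric N = 0.
  have L1 : mcvg (fun k => lyap (A + W *m u k) (u k.+1)) (lyap (A + W *m N) N).
    rewrite /lyap; have uN' := mcvg_shift uN.
    have uF : mcvg (fun k => A + W *m u k) (A + W *m N).
      by apply: mcvgD; [apply: mcvg_cst | apply: mcvgM => //; apply: mcvg_cst].
    by apply: mcvgD; apply: mcvgM => //; apply: mcvg_tr.
  have L2 : mcvg (fun k => lyap (A + W *m u k) (u k.+1)) (N *m W *m N - S).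
    have -> : (fun k => lyap (A + W *m u k) (u k.+1)) = (fun k => u k *m W *m u k - S).
      by apply/funext => k; have [] := Hf _ (u_good k).
    apply: mcvgD; last by apply: mcvgN; apply: mcvg_cst.
    by apply: mcvgM => //; apply: mcvgM => //; apply: mcvg_cst.
  have := mcvg_unique L1 L2; rewrite ric_lyap // subrr mulmx0 subr0 => /matrixP h.
  by apply/matrixP => i j; have := h i j; mxentry => h'; lra.
(* The limit retains only the weak inequality with [M]; strictness of [M] restores both
   antistability and a definite gap. *)
have [hN NM0] := ric_antistable sN sM M0 (ltac:(rewrite rN; exact: psd0)) NM.
by exists N.
Qed.

End Riccati.

(** The difference of two solutions satisfies a Sylvester equation with one closed loop on each
    side. No sign of [W] enters, so this also serves the indefinite equation of [P]. *)
Lemma ric_unique (R : realType) n (A W S N M : 'M[R]_n) :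
  W^T = W -> N^T = N -> ric A W S N = 0 -> ric A W S M = 0 ->
  hurwitz (A + W *m N) -> hurwitz (A + W *m M) -> N = M.
Proof.
move=> sW sN rN rM hN hM; apply/eqP; rewrite -subr_eq0; apply/eqP.
apply: (sylvester_inj (hurwitz_tr hN) hM).
rewrite [(A + _)^T]linearD /= trmx_mul sN sW.
transitivity (ric A W S N - ric A W S M); last by rewrite rN rM subrr.
by rewrite /ric; mxring.
Qed.

(** * Square roots and trace inequalities *)

Section SquareRoot.
Variables (R : realType) (n : nat).
Implicit Types Q : 'M[R]_n.

(* A square root of Q is a Riccati solution of N * N - Q = 0. *)
Lemma posdef_sqrt Q : posdef Q -> exists2 N, posdef N & N *m N = Q.
Proof.
move=> Q0; have sQ := posdef_sym Q0.
have rE N : ric 0 1%:M (- Q) N = N *m N - Q.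
  by rewrite /ric mulmx0 trmx0 mul0mx !add0r mulmx1.
have sNQ : (- Q)^T = - Q by rewrite linearN /= sQ.
have r0 : posdef (- ric 0 1%:M (- Q) 0) by rewrite rE mul0mx sub0r opprK.
have [N [sN + _ +]] := riccati_solution (posdef1 R n) sNQ (trmx0 R n n) r0.
rewrite rE subr0 => /eqP; rewrite subr_eq0 => /eqP NQ N0.
by exists N.
Qed.

Lemma msqrtP Q : posdef Q -> possemidef (msqrt Q) /\ msqrt Q *m msqrt Q = Q.
Proof.
move=> /posdef_sqrt[N N0 NQ].
apply: (ClassicalEpsilon.epsilon_spec (inhabits 0) (fun S => possemidef S /\ S *m S = Q)).
by exists N; split=> //; apply: posdef_psd.
Qed.

Lemma mxtrace_square_eq0 p (T : 'M[R]_(p, n)) : \tr (T^T *m T) = 0 -> T = 0.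
Proof.
move=> /psumr_eq0P T0; apply/matrixP => i j; rewrite mxE.
have sq k l : 0 <= T k l ^+ 2 by rewrite sqr_ge0.
have TE k : (T^T *m T) k k = \sum_l T l k ^+ 2.
  by rewrite mxE; apply: eq_bigr => l _; rewrite mxE expr2.
have : \sum_l T l j ^+ 2 = 0.
  by rewrite -TE; apply: T0 => // k _; rewrite TE sumr_ge0.
by move=> /psumr_eq0P h; apply/eqP; rewrite -sqrf_eq0; apply/eqP/h.
Qed.

Lemma mxtrace_psd_ge0 (D : 'M[R]_n) : possemidef D -> 0 <= \tr D.
Proof. by move=> D0; rewrite /mxtrace sumr_ge0 // => i _; rewrite -bf_delta psd_bf. Qed.

Lemma mxtrace_posdef_psd Q (D : 'M[R]_n) : posdef Q -> possemidef D -> 0 <= \tr (Q *m D).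
Proof.
move=> /posdef_sqrt[N N0 <-] D0; rewrite -mulmxA mxtrace_mulC.
apply: mxtrace_psd_ge0; rewrite -{1}(posdef_sym N0); exact: psd_congr.
Qed.

End SquareRoot.

(** * The H-infinity norm in real terms *)

Section HinfNorm.
Variables (R : realType) (k n m : nat) (C : 'M[R]_(k, n)) (A : 'M[R]_n) (D : 'M[R]_(n, m)).

Lemma cvnorm_cmx l (u v : 'cV[R]_l) : cvnorm (cmx u v) = Num.sqrt (bf 1%:M u u + bf 1%:M v v).
Proof.
by rewrite /cvnorm !bf1E -big_split; congr Num.sqrt; apply: eq_bigr => i _; rewrite !mxE.
Qed.

Lemma hurwitz_resolvent w : hurwitz A -> (0 +i* w)%C%:M - MtoC A \in unitmx.
Proof.
move=> hA; rewrite -opprB -scaleN1r unitmxZ ?unitrN1 //; apply: contraT.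
by rewrite -eigenvalueE => /hA /=; rewrite ltxx.
Qed.

(** Real and imaginary parts of (i w - A)(x1 + i x2) = D (p + i q). *)
Definition freq_eq w (x1 x2 : 'cV[R]_n) (p q : 'cV[R]_m) :=
  - (A *m x1) - w *: x2 = D *m p /\ w *: x1 - A *m x2 = D *m q.

Lemma freq_eqE w x1 x2 p q : hurwitz A ->
  freq_eq w x1 x2 p q <->
  invmx ((0 +i* w)%C%:M - MtoC A) *m MtoC D *m cmx p q = cmx x1 x2.
Proof.
move=> hA; have U := hurwitz_resolvent w hA.
have E : ((0 +i* w)%C%:M - MtoC A) *m cmx x1 x2 =
    cmx (- (A *m x1) - w *: x2) (w *: x1 - A *m x2).
  rewrite mulmxBl mul_scalar_mx cmx_scale cmx_mull cmxN cmxD !scale0r sub0r addr0.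
  by rewrite addrC.
split=> [[e1 e2]|h]; first by rewrite -mulmxA cmx_mull -e1 -e2 -E mulKmx.
by move: E; rewrite -h -mulmxA mulKVmx // cmx_mull => /cmx_inj[e1 e2]; split.
Qed.

Let hset := [set r : R | exists (w : R) (v : 'cV[R[i]]_m), cvnorm v = 1 /\
     r = cvnorm (MtoC C *m invmx ((0 +i* w)%C%:M - MtoC A) *m MtoC D *m v)]%classic.

Lemma hset_elt r : hurwitz A -> hset r <-> exists w x1 x2 p q,
  [/\ freq_eq w x1 x2 p q, bf 1%:M p p + bf 1%:M q q = 1 &
      r = Num.sqrt (bf (C^T *m C) x1 x1 + bf (C^T *m C) x2 x2)].
Proof.
move=> hA; split.
  move=> [w [v []]]; have [p [q ->]] := cmx_surj v.
  rewrite cvnorm_cmx => pq; rewrite -!mulmxA [invmx _ *m _]mulmxA.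
  have [x1 [x2 e]] := cmx_surj (invmx ((0 +i* w)%C%:M - MtoC A) *m MtoC D *m cmx p q).
  rewrite e cmx_mull cvnorm_cmx => ->.
  exists w, x1, x2, p, q; split; first exact/freq_eqE.
    rewrite -[LHS]sqr_sqrtr ?pq ?expr1n //.
    by rewrite addr_ge0 ?bf1_ge0.
  by rewrite !bf_square.
move=> [w [x1 [x2 [p [q [e pq ->]]]]]]; exists w, (cmx p q).
rewrite cvnorm_cmx pq sqrtr1; split=> //.
rewrite -!mulmxA [invmx _ *m _]mulmxA ((freq_eqE _ _ _ _ _ hA).1 e).
by rewrite cmx_mull cvnorm_cmx !bf_square.
Qed.

(** [c] bounds the squared gain; homogeneity removes the normalisation of the input. *)
Definition gain_le c := forall w x1 x2 p q, freq_eq w x1 x2 p q ->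
  bf (C^T *m C) x1 x1 + bf (C^T *m C) x2 x2 <= c * (bf 1%:M p p + bf 1%:M q q).

Lemma gain_le_ubound c : 0 <= c -> hurwitz A -> gain_le (c ^+ 2) -> ubound hset c.
Proof.
move=> c0 hA gc r /(hset_elt _ hA)[w [x1 [x2 [p [q [e pq ->]]]]]].
rewrite -ler_sqr ?nnegrE ?sqrtr_ge0 // sqr_sqrtr.
  by rewrite -[c ^+ 2]mulr1 -pq; apply: gc e.
by rewrite addr_ge0 // bf_square bf1_ge0.
Qed.

Lemma hinf_norm_le c : 0 <= c -> hurwitz A -> gain_le (c ^+ 2) -> hinf_norm C A D <= c.
Proof.
move=> c0 hA gc; have ub := gain_le_ubound c0 hA gc.
rewrite /hinf_norm -/hset; have [[r hr]|he] := pselect (hset !=set0)%classic.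
  by apply: sup_le_ub => //; exists r.
(* Without inputs there is no unit vector, and [sup] has the default value 0. *)
by rewrite sup_out // => -[].
Qed.

(** The a priori bound [c0] guarantees that [sup] is a genuine supremum; rescaling to a unit input
    then gives the gain. *)
Lemma hinf_norm_gain c0 : 0 <= c0 -> hurwitz A -> gain_le (c0 ^+ 2) ->
  0 <= hinf_norm C A D /\ gain_le (hinf_norm C A D ^+ 2).
Proof.
move=> c00 hA gc; have ub := gain_le_ubound c00 hA gc.
have t0 : 0 <= hinf_norm C A D.
  rewrite /hinf_norm -/hset; have [[r hr]|he] := pselect (hset !=set0)%classic.
    apply: le_trans (_ : r <= _).
      by have [? [? [? [? [? [_ _ ->]]]]]] := (hset_elt _ hA).1 hr; rewrite sqrtr_ge0.
    by apply: sup_upper_bound => //; split; [exists r | exists c0].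
  by rewrite sup_out // => -[].
split=> // w x1 x2 p q e.
set P := bf 1%:M p p + bf 1%:M q q; set X := bf _ x1 x1 + bf _ x2 x2.
have X0 : 0 <= X by rewrite addr_ge0 // bf_square bf1_ge0.
have P0 : 0 <= P by rewrite addr_ge0 // bf1_ge0.
have [PX|Pn] := eqVneq P 0.
  by rewrite PX mulr0; have := gc _ _ _ _ _ e; rewrite -/P -/X PX mulr0.
have Pp : 0 < P by rewrite lt_def Pn.
set s := (Num.sqrt P)^-1.
have sP : s ^+ 2 * P = 1 by rewrite exprVn sqr_sqrtr // mulVf.
have hs : hset (Num.sqrt (s ^+ 2 * X)).
  apply/(hset_elt _ hA); exists w, (s *: x1), (s *: x2), (s *: p), (s *: q); split.
  - case: e => e1 e2; split.
      by rewrite -!scalemxAr -e1 scalerBr scalerN !scalerA mulrC.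
    by rewrite -!scalemxAr -e2 scalerBr !scalerA mulrC.
  - by rewrite !(bfZl, bfZr) !mulrA -expr2 -mulrDr.
  - by rewrite !(bfZl, bfZr) !mulrA -expr2 -mulrDr.
have : Num.sqrt (s ^+ 2 * X) <= hinf_norm C A D.
  by apply: sup_upper_bound => //; split; [eexists; exact: hs | exists c0].
rewrite -ler_sqr ?nnegrE ?sqrtr_ge0 // sqr_sqrtr; last by rewrite mulr_ge0 // sqr_ge0.
by rewrite exprVn sqr_sqrtr // mulrC ler_pdivrMr.
Qed.

End HinfNorm.

(** * The strict bounded real lemma *)

Section BoundedReal.
Variables (R : realType) (p0 n m : nat) (C : 'M[R]_(p0, n)) (A : 'M[R]_n) (D : 'M[R]_(n, m)).
Let W := D *m D^T.
Let S := C^T *m C.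
Hypothesis W0 : posdef W.
Implicit Types M N : 'M[R]_n.

Let sW : W^T = W := posdef_sym W0.
Let sS : S^T = S. Proof. by rewrite /S trmx_mul trmxK. Qed.
Let sgS g : (g *: S)^T = g *: S. Proof. by rewrite linearZ /= sS. Qed.
Let S0 : possemidef S.
Proof. by split=> // x; rewrite -/(bf S x x) bf_square bf1_ge0. Qed.

(** The bounded real Riccati inequality, with [g] as the inverse squared gain. Putting the level on
    [S] keeps [W] fixed and makes sense of the level 0. *)
Definition strict g := exists2 M, M^T = M & posdef (- ric A W (g *: S) M).

Lemma ric_shift g h N : ric A W (h *: S) N = ric A W (g *: S) N + (h - g) *: S.
Proof. by rewrite /ric scalerBl -[RHS]addrA [g *: S + _]addrC subrK. Qed.

Lemma strict_le g h : g <= h -> strict h -> strict g.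
Proof.
move=> gh [M sM M0]; exists M => //; rewrite (ric_shift h) opprD -scaleNr opprB.
by apply: posdef_psdD => //; apply: psdZ; rewrite ?subr_ge0.
Qed.

Lemma strict_open g : strict g -> exists2 h, g < h & strict h.
Proof.
move=> [M sM M0]; have [e e0 He] := posdef_perturbZ M0 sS.
exists (g + e / 2); first lra.
exists M => //; rewrite (ric_shift g) opprD -scaleNr; apply: He.
by rewrite addrAC subrr add0r normrN gtr0_norm; lra.
Qed.

Lemma bf_ric g N x : N^T = N ->
  bf (ric A W (g *: S) N) x x = bf N x (A *m x) *+ 2 + bf W (N *m x) (N *m x) + g * bf S x x.
Proof.
move=> sN.
have e1 : bf (N *m A) x x = bf N x (A *m x) by exact: bf_mulr.
have e2 : bf (A^T *m N) x x = bf N x (A *m x) by rewrite bf_mull trmxK bf_sym.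
have e3 : bf (N *m W *m N) x x = bf W (N *m x) (N *m x) by rewrite bf_mulr bf_mull sN.
by rewrite /ric !bfDm bfZm e1 e2 e3 mulr2n.
Qed.

(** Dissipation at a fixed frequency: the terms in [w] cancel between real and imaginary parts, and
    the deficit is the square of [D^T M x - p] and its analogue for [q]. *)
Lemma strict_gain g : 0 < g -> strict g -> gain_le C A D g^-1.
Proof.
move=> g0 [M sM M0] w x1 x2 p q [e1 e2]; rewrite mulrC ler_pdivlMr // mulrC.
have := psd_bf x1 (posdef_psd M0); have := psd_bf x2 (posdef_psd M0).
rewrite !bfNm !bf_ric //.
have -> : A *m x1 = - (w *: x2) - D *m p by rewrite -e1 opprB opprK addKr.
have -> : A *m x2 = w *: x1 - D *m q by rewrite -e2 opprB addrC subrK.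
have WE x : bf W (M *m x) (M *m x) = bf 1%:M (D^T *m (M *m x)) (D^T *m (M *m x)).
  by rewrite -[W]/(D *m D^T) -[D in D *m _]trmxK bf_square.
have DE x y : bf M x (D *m y) = bf 1%:M (D^T *m (M *m x)) y.
  by rewrite -bf_mulr -[M *m D]mulmx1 bf_mull trmx_mul sM mulmxA.
rewrite !WE !(bfDr, bfNr, bfZr) !DE (bf_sym x2 x1 sM).
have := bf1_ge0 (D^T *m (M *m x1) - p); have := bf1_ge0 (D^T *m (M *m x2) - q).
rewrite !(bfDl, bfDr, bfNl, bfNr) (bf_sym p) ?trmx1 // (bf_sym q) ?trmx1 //.
by rewrite -/S; move=> *; lra.
Qed.

Lemma strict_hinf b : 0 < b -> hurwitz A -> strict (b ^- 2) -> hinf_norm C A D < b.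
Proof.
move=> b0 hA /strict_open[h bh sh].
have h0 : 0 < h by apply: lt_trans bh; rewrite invr_gt0 exprn_gt0.
have : hinf_norm C A D <= Num.sqrt h^-1.
  by apply: hinf_norm_le; rewrite ?sqrtr_ge0 ?sqr_sqrtr ?invr_ge0 ?ltW //; apply: strict_gain.
move/le_lt_trans; apply; rewrite -ltr_sqr ?nnegrE ?sqrtr_ge0 ?ltW //.
by rewrite sqr_sqrtr ?invr_ge0 ?ltW // -[b ^+ 2]invrK ltf_pV2 ?posrE ?invr_gt0 ?exprn_gt0.
Qed.

Lemma strict0 : hurwitz A -> strict 0.
Proof.
move=> hA; have s0 : (0 : 'M[R]_n)^T = 0 by exact: trmx0.
have r0 : ric A W (0 *: S) 0 = 0 by rewrite /ric scale0r !mul0mx mulmx0 !addr0.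
have sE : (lyap_sol A (- 1%:M))^T = lyap_sol A (- 1%:M).
  by apply: lyap_sol_sym; rewrite // linearN /= trmx1.
apply: (ric_solve_strict W0 s0 r0 sE).
by rewrite mulmx0 addr0 lyap_solP.
Qed.

Lemma hurwitz_gain : hurwitz A -> exists2 c, 0 <= c & gain_le C A D (c ^+ 2).
Proof.
move=> /strict0/strict_open[h h0 sh]; exists (Num.sqrt h^-1); first exact: sqrtr_ge0.
by rewrite sqr_sqrtr ?invr_ge0 ?ltW //; apply: strict_gain.
Qed.

Lemma psd_square_le (E : 'M[R]_n) x : possemidef E ->
  bf 1%:M (E *m x) (E *m x) <= ent_sum E * bf E x x.
Proof.
move=> E0; have sE := psd_sym E0; set y := E *m x.
have [->|y0] := eqVneq y 0; first by rewrite bf0l mulr_ge0 ?ent_sum_ge0 ?psd_bf.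
have e : bf E x y = bf 1%:M y y by rewrite -{1}[E]mulmx1 bf_mull sE.
have := psd_CauchySchwarz x y E0; rewrite e.
have := bf_ub E y; have := bf1_gt0 y0; have := psd_bf x E0.
set a := bf 1%:M y y; set b := bf E x x; set d := bf E y y => b0 a0 h1 h2.
have : a ^+ 2 <= b * (ent_sum E * a) by apply: le_trans h2 _; apply: ler_wpM2l.
by rewrite expr2 mulrA ler_pM2r // mulrC.
Qed.

(* As E -> 0 the quadratic term becomes negligible against E itself. *)
Lemma psd_sandwich_le (E : 'M[R]_n) x : possemidef E ->
  bf (E *m W *m E) x x <= ent_sum W * ent_sum E * bf E x x.
Proof.
move=> E0; rewrite bf_mulr bf_mull psd_sym //.
apply: le_trans (bf_ub _ _) _; rewrite -mulrA ler_wpM2l ?ent_sum_ge0 //.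
exact: psd_square_le.
Qed.

Local Open Scope classical_set_scope.

Lemma mcvg_ent_sum (u : nat -> 'M[R]_n) : mcvg u 0 -> ((fun k => ent_sum (u k)) @ \oo --> (0 : R))%classic.
Proof.
move=> u0.
have c1 i : (fun k => \sum_j `|u k i j|) @ \oo --> (0 : R).
  have := @cvg_sumr R _ (index_enum _) (fun j k => `|u k i j|) (fun=> 0) _.
  rewrite big1 //; apply=> j.
  have := cvg_norm (u0 i j); rewrite mxE normr0 => h; exact: h.
have := @cvg_sumr R _ (index_enum _) (fun i k => \sum_j `|u k i j|) (fun=> 0) c1.
by rewrite big1.
Qed.

Hypothesis SS0 : posdef S.

(** The level is the supremum of the feasible ones, infeasible itself because feasibility is open.
    The nearby solutions [M] are exported along with the limit: they later exclude eigenvalues off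
    the imaginary axis. *)
Lemma critical_level b : 0 < b -> hurwitz A -> ~ strict b ->
  exists g N, [/\ 0 < g <= b, ~ strict g, N^T = N, ric A W (g *: S) N = 0 &
    forall e, 0 < e -> exists h M, [/\ h < g, M^T = M, possemidef (M - N),
      ric A W (g *: S) M = (g - h) *: S & ent_sum (M - N) < e]].
Proof.
move=> b0 hA nb.
pose G := [set g : R | 0 <= g /\ strict g]%classic.
have ubG : ubound G (b).
  by move=> g [g0 sg]; rewrite leNgt; apply/negP => /ltW/strict_le/(_ sg).
have G0 : G 0 by split; [|exact: strict0].
have supG : has_sup G by split; [exists 0 | exists (b)].
set g := sup G.
have gb : g <= b by apply: sup_le_ub => //; exists 0.
have g0 : 0 < g.
  have [h h0 sh] := strict_open (strict0 hA).
  by apply: (lt_le_trans h0); exact: (sup_upper_bound supG (conj (ltW h0) sh)).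
have nG : ~ strict g.
  move=> /strict_open[h gh sh]; have : h <= g.
    exact: (sup_upper_bound supG (conj (ltW (lt_trans g0 gh)) sh)).
  by rewrite leNgt gh.
(* Feasibility is downward closed, so all these levels from 0 up towards [g] are feasible. *)
pose gk k : R := g - g * k.+1%:R^-1.
have gk_lt k : gk k < g by rewrite /gk ltrBlDr ltrDl mulr_gt0 // invr_gt0 ltr0n.
have gk_mono k : gk k <= gk k.+1.
  by rewrite /gk lerD2l lerN2 ler_pM2l // lef_pV2 ?posrE ?ltr0n // ler_nat.
have gk_ge0 k : 0 <= gk k.
  by rewrite /gk subr_ge0 -[leRHS]mulr1 ler_pM2l // invf_le1 ?ltr0n // ler1n.
have gk_strict k : strict (gk k).
  have [|h [h0 sh] hg] := @sup_adherent _ G (g - gk k) _ supG; first by rewrite subr_gt0.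
  by apply: strict_le sh; rewrite -/g in hg; lra.
have solk k : exists N, [/\ N^T = N, ric A W (gk k *: S) N = 0 & hurwitz (- (A + W *m N))].
  have [M sM M0] := gk_strict k.
  by have [N [? ? ? _]] := riccati_solution W0 (sgS (gk k)) sM M0; exists N.
have [u Hu] := choice solk.
have su k : (u k)^T = u k by have [] := Hu k.
have ru k h : ric A W (h *: S) (u k) = (h - gk k) *: S.
  by rewrite (ric_shift (gk k)); have [_ -> _] := Hu k; rewrite add0r.
(* [u k] is the largest subsolution at its level, and [u k.+1] is a subsolution there. *)
have u_mono k : possemidef (u k - u k.+1).
  have [_ r1 h1] := Hu k; apply: (ric_max W0 (su k) (su _) h1 (S := gk k *: S)).
  rewrite r1 ru sub0r -scaleNr opprB; apply: psdZ => //; by rewrite subr_ge0.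
have u_psd k : possemidef (u k).
  apply: (lyap_psd hA) => //.
  have -> : - lyap A (u k) = gk k *: S + u k *m W *m u k.
    have [_ + _] := Hu k; rewrite /ric /lyap => /matrixP e; apply/matrixP => i j.
    by have := e i j; mxentry => e'; lra.
  by apply: psdD; [apply: psdZ | apply: psd_sandwich].
have u_psd0 k : possemidef (u k - 0) by rewrite subr0.
have [N uN] := mcvg_monotone su u_mono u_psd0.
have sN : N^T = N by apply: (mcvg_unique (mcvg_tr uN)); under eq_fun do rewrite su.
have uNk k : possemidef (u k - N).
  apply: (mcvg_psd (u := fun l => u k - u (k + l)%N)) => [|l].
    apply: mcvgD; first exact: mcvg_cst.
    apply: mcvgN => i j; have := uN i j; rewrite -(cvg_shiftn k) => h.
    by under eq_fun do rewrite addnC.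
  elim: l => [|l IH]; first by rewrite addn0 subrr; exact: psd0.
  have -> : u k - u (k + l.+1)%N = (u k - u (k + l)%N) + (u (k + l)%N - u (k + l.+1)%N).
    by rewrite addrA subrK.
  by apply: psdD => //; rewrite addnS.
have gk_cvg : (gk @ \oo --> g)%classic.
  have : gk @ \oo --> g - g * 0.
    apply: cvgB; first exact: cvg_cst.
    by apply: cvgM; [exact: cvg_cst | exact: cvg_harmonic].
  by rewrite mulr0 subr0; exact.
have rN : ric A W (g *: S) N = 0.
  apply: (mcvg_unique (u := fun k => ric A W (gk k *: S) (u k))); last first.
    have -> : (fun k => ric A W (gk k *: S) (u k)) = fun=> 0.
      by apply/funext => k; rewrite ru subrr scale0r.
    exact: mcvg_cst.
  rewrite /ric; apply: mcvgD.
    apply: mcvgD; first by apply: mcvgD; apply: mcvgM => //; exact: mcvg_cst.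
    by apply: mcvgM => //; apply: mcvgM => //; exact: mcvg_cst.
  move=> i j; rewrite mxE; under eq_fun do rewrite mxE.
  by apply: cvgM => //; exact: cvg_cst.
exists g, N; split=> // [|e e0]; first by rewrite g0.
have uN0 : mcvg (fun k => u k - N) 0.
  by have := mcvgD uN (mcvgN (@mcvg_cst R n n N)); rewrite subrr.
have /cvgr0_norm_lt/(_ _ e0)[k _ hk] := mcvg_ent_sum uN0.
exists (gk k), (u k); split=> //; apply: le_lt_trans (ler_norm _) _.
exact: (hk k (leqnn k)).
Qed.

(* At the critical level g the Riccati solution N is only marginally antistable, and
   an imaginary eigenvalue of A + W N exhibits the frequency at which the gain is g^-1. *)
Lemma hinf_strict b : 0 < b -> hurwitz A -> hinf_norm C A D < b -> strict (b ^- 2).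
Proof.
move=> b0.
have gain_lt1 t g : 0 <= t -> t < b -> g <= b ^- 2 -> t ^+ 2 * g < 1.
  move=> t0 tb gb; apply: le_lt_trans (_ : t ^+ 2 * b ^- 2 < 1).
    by rewrite ler_wpM2l ?sqr_ge0.
  by rewrite ltr_pdivrMr ?exprn_gt0 // mul1r ltr_sqr // nnegrE ltW.
move=> hA hb; apply: contrapT => nb.
have [c c0 gc] := hurwitz_gain hA.
have [t0 gt] := hinf_norm_gain c0 hA gc.
move: (hinf_norm C A D) t0 gt hb => t t0 gt hb.
have b20 : 0 < b ^- 2 by rewrite invr_gt0 exprn_gt0.
have [g [N [/andP[g0 gb] nG sN rN approx]]] := critical_level b20 hA nb.
pose F := - (A + W *m N).
(* A Hurwitz [F] would allow a first-order step from [N] to a strict subsolution at the critical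
   level. *)
have nF : ~ hurwitz F.
  move=> hF; apply: nG.
  have sE : (lyap_sol F 1%:M)^T = lyap_sol F 1%:M by apply: lyap_sol_sym; rewrite // trmx1.
  apply: (ric_solve_strict W0 sN rN sE).
  by rewrite -[A + _]opprK lyapNl -/F lyap_solP.
have [a [w [x [y [a0 Fx Fy xy0]]]]] := not_hurwitz nF.
have Sxy : 0 < bf S x x + bf S y y.
  have := psd_bf x S0; have := psd_bf y S0.
  by case/orP: xy0 => /(posdef_bf SS0) *; lra.
(* If a > 0, evaluate [lyap F (M - N)] on the eigenvector: this gives 2a times the form of [M - N].
   For [M] close to [N] the quadratic term contributes at most a times that form, and the strictly
   negative [(g - h)] term yields a contradiction. *)
have a00 : a = 0.
  apply/eqP; rewrite eq_le a0 andbT leNgt; apply/negP => ap.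
  have W1 : 0 < ent_sum W + 1 by rewrite ltr_wpDl ?ent_sum_ge0.
  have [h [M [hg sM MN rM]]] := approx _ (divr_gt0 ap W1).
  rewrite (ltr_pdivlMr _ _ W1) => small.
  have sE := psd_sym MN.
  have lyF : lyap F (M - N) = (M - N) *m W *m (M - N) - (g - h) *: S.
    rewrite lyapNl lyapB (ric_lyap A (g *: S) W0 M sN) (ric_lyap A (g *: S) W0 N sN).
    by rewrite rM rN subrr mulmx0; apply/matrixP => i j; mxentry; ring.
  move: (M - N) MN small sE lyF => E MN small sE lyF.
  have := psd_sandwich_le x MN; have := psd_sandwich_le y MN.
  have := bf_lyap F x sE; have := bf_lyap F y sE; rewrite lyF !bfDm !bfNm !bfZm Fx Fy.
  rewrite !(bfDr, bfNr, bfZr) (bf_sym y x sE).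
  have := psd_bf x MN; have := psd_bf y MN.
  have gpos : 0 < (g - h) * (bf S x x + bf S y y).
    by apply: mulr_gt0; [rewrite subr_gt0; exact: hg | exact: Sxy].
  have We : ent_sum W * ent_sum E <= a by have := ent_sum_ge0 E; nra.
  set X := bf E x x; set Y := bf E y y => Y0 X0 e1 e2 h1 h2.
  have h3 : ent_sum W * ent_sum E * X <= a * X by apply: ler_wpM2r.
  have h4 : ent_sum W * ent_sum E * Y <= a * Y by apply: ler_wpM2r.
  have aX : 0 <= a * X by rewrite mulr_ge0.
  have aY : 0 <= a * Y by rewrite mulr_ge0.
  by lra.
rewrite a00 !scale0r sub0r addr0 in Fx Fy.
have eA z : A *m z = - (F *m z) - W *m (N *m z).
  by rewrite /F mulNmx opprK mulmxDl -mulmxA addrK.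
have DE z : D *m (D^T *m (N *m z)) = W *m (N *m z) by rewrite mulmxA.
(* The worst-case input is [D^T N z]; the frequency is -w because F = -(A + W N). The Riccati
   identity will make the squared input exactly [g] times the squared output. *)
have fe : freq_eq A D (- w) x y (D^T *m (N *m x)) (D^T *m (N *m y)).
  split; rewrite DE eA ?Fx ?Fy scaleNr ?opprK opprB.
    by rewrite subrK.
  by rewrite opprK addrCA addNr addr0.
have := gt (- w) x y (D^T *m (N *m x)) (D^T *m (N *m y)).
move/(_ fe).
have DW z : bf 1%:M (D^T *m (N *m z)) (D^T *m (N *m z)) = bf W (N *m z) (N *m z).
  by rewrite -bf_square trmxK.
rewrite !DW -/S; have := bf_ric g x sN; have := bf_ric g y sN.
rewrite rN !bf0m !eA Fx Fy !(bfDr, bfNr, bfZr) opprK (bf_sym y x sN).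
have WN z : bf N z (W *m (N *m z)) = bf W (N *m z) (N *m z).
  by rewrite -(bf_mulr N W) bf_mull sN.
rewrite !WN => e1 e2 h.
have gS : bf W (N *m x) (N *m x) + bf W (N *m y) (N *m y) = g * (bf S x x + bf S y y) by lra.
rewrite gS mulrA -[leLHS]mul1r (ler_pM2r Sxy) in h.
have := gain_lt1 t g t0 hb gb.
by rewrite ltNge h.
Qed.

End BoundedReal.

(** * Orders of vanishing at 0 *)

Section VanishingOrder.
Variables (R : realType) (m n : nat).
Implicit Types (p q r k : nat) (H : 'M[R]_(m, n)).

(** Entrywise O(|H|^k); the restriction to the unit ball lets a higher order imply a lower one. *)
Definition order k p q (f : 'M[R]_(m, n) -> 'M[R]_(p, q)) :=
  exists2 c, 0 <= c & forall H, `|H| <= 1 -> forall i j, `|f H i j| <= c * `|H| ^+ k.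

Lemma order_cst p q (M : 'M[R]_(p, q)) : order 0 (fun=> M).
Proof.
exists (ent_sum M); first exact: ent_sum_ge0.
move=> H _ i j; rewrite expr0 mulr1 /ent_sum (bigD1 i) //= (bigD1 j) //= -addrA.
by rewrite lerDl addr_ge0 ?sumr_ge0 // => i' _; rewrite sumr_ge0.
Qed.

Lemma entry_le_norm H i j : `|H i j| <= `|H|.
Proof.
rewrite [leRHS]/Num.norm /= mx_normrE.
exact: (@le_bigmax_cond _ _ _ _ (i, j) xpredT (fun ij => `|H ij.1 ij.2|)).
Qed.

Lemma order_id : order 1 id.
Proof. by exists 1 => // H _ i j; rewrite mul1r expr1 entry_le_norm. Qed.

Lemma order_weak k k' p q (f : 'M[R]_(m, n) -> 'M[R]_(p, q)) :
  (k' <= k)%N -> order k f -> order k' f.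
Proof.
move=> kk [c c0 Hc]; exists c => // H H1 i j; apply: le_trans (Hc H H1 i j) _.
by rewrite ler_wpM2l // ler_wiXn2l.
Qed.

Lemma orderD k p q (f g : 'M[R]_(m, n) -> 'M[R]_(p, q)) :
  order k f -> order k g -> order k (fun H => f H + g H).
Proof.
move=> [c c0 Hc] [d d0 Hd]; exists (c + d) => [|H H1 i j]; first exact: addr_ge0.
by rewrite mxE mulrDl; apply: le_trans (ler_normD _ _) _; rewrite lerD ?Hc ?Hd.
Qed.

Lemma orderN k p q (f : 'M[R]_(m, n) -> 'M[R]_(p, q)) :
  order k f -> order k (fun H => - f H).
Proof. by move=> [c c0 Hc]; exists c => // H H1 i j; rewrite mxE normrN Hc. Qed.

Lemma orderT k p q (f : 'M[R]_(m, n) -> 'M[R]_(p, q)) :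
  order k f -> order k (fun H => (f H)^T).
Proof. by move=> [c c0 Hc]; exists c => // H H1 i j; rewrite mxE Hc. Qed.

Lemma orderM k l p q r (f : 'M[R]_(m, n) -> 'M[R]_(p, q)) (g : 'M[R]_(m, n) -> 'M[R]_(q, r)) :
  order k f -> order l g -> order (k + l) (fun H => f H *m g H).
Proof.
move=> [c c0 Hc] [d d0 Hd]; exists (q%:R * (c * d)) => [|H H1 i j].
  by rewrite !mulr_ge0.
rewrite mxE; apply: le_trans (ler_norm_sum _ _ _) _.
have -> : q%:R * (c * d) * `|H| ^+ (k + l) = \sum_(s < q) (c * `|H| ^+ k) * (d * `|H| ^+ l).
  by rewrite sumr_const card_ord -mulr_natl exprD; ring.
by apply: ler_sum => s _; rewrite normrM ler_pM ?Hc ?Hd.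
Qed.

Lemma orderM0l k p q r (M : 'M[R]_(p, q)) (g : 'M[R]_(m, n) -> 'M[R]_(q, r)) :
  order k g -> order k (fun H => M *m g H).
Proof. exact: (orderM (order_cst M)). Qed.

Lemma orderM0r k p q r (f : 'M[R]_(m, n) -> 'M[R]_(p, q)) (M : 'M[R]_(q, r)) :
  order k f -> order k (fun H => f H *m M).
Proof. by move=> fk; have := orderM fk (order_cst M); rewrite addn0. Qed.

Lemma orderZ k p q a (f : 'M[R]_(m, n) -> 'M[R]_(p, q)) :
  order k f -> order k (fun H => a *: f H).
Proof.
move=> [c c0 Hc]; exists (`|a| * c) => [|H H1 i j]; first by rewrite mulr_ge0.
by rewrite mxE normrM -mulrA ler_wpM2l ?Hc.
Qed.

Lemma order_normZ p q a (M : 'M[R]_(p, q)) : order 1 (fun H => (a * `|H|) *: M).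
Proof.
have [c c0 Hc] := order_cst M; exists (`|a| * c) => [|H H1 i j]; first by rewrite mulr_ge0.
rewrite mxE !normrM normr_id expr1 mulrAC ler_wpM2r // ler_wpM2l //.
by apply: le_trans (Hc H H1 i j) _; rewrite expr0 mulr1.
Qed.

Lemma order_mxvec k p q (f : 'M[R]_(m, n) -> 'M[R]_(p, q)) :
  order k f -> order k (fun H => mxvec (f H)).
Proof.
move=> [c c0 Hc]; exists c => // H H1 i l.
by rewrite ord1; case/mxvec_indexP: l => i' j'; rewrite mxvecE Hc.
Qed.

Lemma order_vec_mx k p q (f : 'M[R]_(m, n) -> 'rV[R]_(p * q)) :
  order k f -> order k (fun H => vec_mx (f H)).
Proof. by move=> [c c0 Hc]; exists c => // H H1 i j; rewrite mxE Hc. Qed.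

Lemma order_lyap_sol k p (M : 'M[R]_p) (f : 'M[R]_(m, n) -> 'M[R]_p) :
  order k f -> order k (fun H => lyap_sol M (f H)).
Proof. by move=> fk; apply/order_vec_mx/orderM0r/order_mxvec. Qed.

Lemma order_ent_sum k p q (f : 'M[R]_(m, n) -> 'M[R]_(p, q)) : order k f ->
  exists2 c, 0 <= c & forall H, `|H| <= 1 -> ent_sum (f H) <= c * `|H| ^+ k.
Proof.
move=> [c c0 Hc]; exists (\sum_(i < p) \sum_(j < q) c) => [|H H1].
  by apply: sumr_ge0 => i _; apply: sumr_ge0.
rewrite mulr_suml; apply: ler_sum => i _; rewrite mulr_suml; apply: ler_sum => j _.
exact: Hc.
Qed.

Lemma order_trace k p (f : 'M[R]_(m, n) -> 'M[R]_p) : order k f ->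
  exists2 c, 0 <= c & forall H, `|H| <= 1 -> `|\tr (f H)| <= c * `|H| ^+ k.
Proof.
move=> [c c0 Hc]; exists (\sum_(i < p) c) => [|H H1]; first exact: sumr_ge0.
rewrite mulr_suml; apply: le_trans (ler_norm_sum _ _ _) _; apply: ler_sum => i _.
exact: Hc.
Qed.

Lemma order1_small p q (f : 'M[R]_(m, n) -> 'M[R]_(p, q)) e : 0 < e -> order 1 f ->
  exists2 d, 0 < d & forall H, `|H| < d -> ent_sum (f H) < e.
Proof.
move=> e0 /order_ent_sum[c c0 Hc]; have c1 : 0 < c + 1 by rewrite ltr_wpDl.
exists (Num.min 1 (e / (c + 1))); first by rewrite lt_min ltr01 divr_gt0.
move=> H; rewrite lt_min => /andP[H1]; rewrite ltr_pdivlMr // => He.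
apply: le_lt_trans (Hc H (ltW H1)) _; rewrite expr1; apply: le_lt_trans He.
by rewrite mulrC ler_wpM2l // lerDl.
Qed.

Lemma order1_posdef p (M : 'M[R]_p) (f : 'M[R]_(m, n) -> 'M[R]_p) :
  posdef M -> (forall H, (f H)^T = f H) -> order 1 f ->
  exists2 d, 0 < d & forall H, `|H| < d -> posdef (M + f H).
Proof.
move=> M0 sf fk; have [e e0 He] := posdef_perturb M0.
have [d d0 Hd] := order1_small e0 fk; exists d => // H /Hd; exact: He.
Qed.

(** A linear multiple of the identity absorbs a quadratic error near 0. At [H = 0] both vanish,
    hence the exclusion. *)
Lemma order2_posdef p e (f : 'M[R]_(m, n) -> 'M[R]_p) :
  0 < e -> (forall H, (f H)^T = f H) -> order 2 f ->
  exists2 d, 0 < d & forall H, H != 0 -> `|H| < d -> posdef ((e * `|H|) *: 1%:M + f H).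
Proof.
move=> e0 sf /order_ent_sum[c c0 Hc]; have c1 : 0 < c + 1 by rewrite ltr_wpDl.
exists (Num.min 1 (e / (c + 1))); first by rewrite lt_min ltr01 divr_gt0.
move=> H H0; rewrite lt_min => /andP[H1]; rewrite ltr_pdivlMr // => He.
split; first by rewrite /Defs.symmetric linearD linearZ /= trmx1 sf.
move=> x x0; rewrite -/(bf _ _ _) bfDm bfZm.
have := bf1_gt0 x0; have := bf_ent_sum (f H) x; have := Hc H (ltW H1).
have : 0 < `|H| by rewrite normr_gt0.
set h := `|H|; set y := bf _ x x; set z := bf _ x x; set w := ent_sum _.
rewrite -/h in He * => h0 hw; rewrite ler_norml => /andP[hz _] y0.
have : w < e * h by apply: le_lt_trans hw _; rewrite expr2; nra.
by move=> hwe; nra.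
Qed.

End VanishingOrder.

(** * Riccati equations under inversion of the unknown *)

Section DualRiccati.
Variables (R : realType) (n : nat) (a W S : 'M[R]_n).
Hypotheses (W0 : posdef W) (S0 : posdef S).
Implicit Types X N M : 'M[R]_n.

Let sW : W^T = W := posdef_sym W0.
Let sS : S^T = S := posdef_sym S0.

Lemma ric_inv X : X \in unitmx ->
  ric a W S (invmx X) = invmx X *m ric a^T S W X *m invmx X.
Proof.
move=> Xu; rewrite /ric trmxK !(mulmxDl, mulmxDr) !mulmxA mulVmx // !mul1mx.
rewrite -!(mulmxA _ X (invmx X)) mulmxV // !mulmx1.
by apply/matrixP => i j; mxentry; ring.
Qed.

(** The closed loops of [X] and of its inverse are similar up to sign, so an antistable solution
    inverts to a stabilizing one. *)
Lemma ric_inv_similar X : posdef X -> ric a^T S W X = 0 ->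
  a^T + S *m X = invmx X *m - (a + W *m invmx X) *m X.
Proof.
move=> X0 rX; have Xu := posdef_unit X0.
have : invmx X *m ric a^T S W X = 0 by rewrite rX mulmx0.
rewrite /ric trmxK !mulmxDr !mulmxA mulVmx // !mul1mx => e.
rewrite mulmxN mulNmx mulmxDr mulmxDl !mulmxA -(mulmxA _ (invmx X) X) mulVmx // mulmx1.
by move/matrixP: e => e; apply/matrixP => i j; have := e i j; mxentry => e'; lra.
Qed.

(** [invmx Xp] is a strict subsolution of the inverted equation; the inverse of the antistable
    solution above it stabilizes, and this stability gives the bound by [Xp]. *)
Lemma dual_solution Xp : posdef Xp -> posdef (- ric a^T S W Xp) ->
  exists X, [/\ posdef X, ric a^T S W X = 0, hurwitz (a^T + S *m X) & possemidef (Xp - X)].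
Proof.
move=> Xp0 rXp; have Xpu := posdef_unit Xp0; have sXp := posdef_sym Xp0.
have N0 := posdef_inv Xp0; have sN0 := posdef_sym N0.
have rN0 : posdef (- ric a W S (invmx Xp)).
  rewrite ric_inv // -mulNmx -mulmxN -{1}sN0; apply: posdef_congr => //.
  by rewrite unitmx_inv.
have [N [sN rN hN NN0]] := riccati_solution W0 sS sN0 rN0.
have Np : posdef N by rewrite -(subrK (invmx Xp) N); apply: posdef_psdD => //; apply: posdef_psd.
have Nu := posdef_unit Np; have Xp' := posdef_inv Np.
have rX : ric a^T S W (invmx N) = 0.
  have := ric_inv (X := invmx N); rewrite unitmx_inv invmxK rN => /(_ Nu)/esym e.
  have : invmx N *m (N *m ric a^T S W (invmx N) *m N) *m invmx N = 0.
    by rewrite e mulmx0 mul0mx.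
  by rewrite !mulmxA mulVmx // mul1mx -mulmxA mulmxV // mulmx1.
have hX : hurwitz (a^T + S *m invmx N).
  by have := ric_inv_similar Xp' rX; rewrite invmxK => ->; exact: hurwitz_sim Nu hN.
exists (invmx N); split=> //.
have sX := posdef_sym Xp'.
apply: (lyap_psd hX); first by rewrite linearB /= sXp sX.
rewrite -lyapN opprB (ric_lyapB a^T W S0) // rX sub0r.
apply: psdD; first exact: posdef_psd.
by apply: psd_sandwich => //; rewrite linearB /= sXp sX.
Qed.

(** Convexity yields the lower bound through the closed loop at [Xm], not at [X], so stability there
    has to be supplied. *)
Lemma dual_lower Xm X : Xm^T = Xm -> X^T = X -> hurwitz (a^T + S *m Xm) ->
  possemidef (ric a^T S W Xm) -> ric a^T S W X = 0 -> possemidef (X - Xm).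
Proof.
move=> sXm sX hXm rXm rX.
apply: (lyap_psd hXm); first by rewrite linearB /= sXm sX.
rewrite -lyapN opprB (ric_lyapB a^T W S0) // rX subr0.
by apply: psdD => //; apply: psd_sandwich => //; rewrite linearB /= sXm sX.
Qed.

(** Stability of [a] gives a sign to the bounded real certificate, which can then be inverted. *)
Lemma strict_subsolution_inv N : hurwitz a -> N^T = N -> posdef (- ric a W S N) ->
  posdef N /\ posdef (- ric a^T S W (invmx N)).
Proof.
move=> ha sN rN.
have Np : posdef N.
  apply: (lyap_posdef ha) => //.
  have -> : - lyap a N = - ric a W S N + (S + N *m W *m N).
    by rewrite /ric /lyap; apply/matrixP => i j; mxentry; ring.
  by apply: posdef_psdD => //; apply: psdD; [exact: posdef_psd | exact: psd_sandwich].
split=> //; have Nu := posdef_unit Np; have Np' := posdef_inv Np.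
have := ric_inv (X := invmx N); rewrite unitmx_inv invmxK => /(_ Nu) e.
have -> : - ric a^T S W (invmx N) = invmx N *m - ric a W S N *m invmx N.
  rewrite e mulmxN mulNmx !mulmxA mulVmx // mul1mx -[_ *m N *m _]mulmxA mulmxV //.
  by rewrite mulmx1.
by rewrite -{1}(posdef_sym Np'); apply: posdef_congr => //; rewrite unitmx_inv.
Qed.

End DualRiccati.

(** * Vanishing differentials *)

Section Differentiable0.
Local Open Scope classical_set_scope.

Lemma differentiable0 (R : realType) (V W : normedModType R) (f : V -> W) x :
  (forall e, 0 < e -> exists2 d, 0 < d & forall h, `|h| < d -> `|f (x + h) - f x| <= e * `|h|) ->
  differentiable f x /\ 'd f x = (fun=> 0) :> (V -> W).
Proof.
move=> fx.
have ex : f \o shift x = cst (f x) + (\0 : {linear V -> W}) +o_ (0 : V) id.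
  apply/eqaddoP => e e0; have [d d0 Hd] := fx e e0.
  apply/nbhs_norm0P; exists d => // h /= hd.
  by rewrite !fctE /= addr0 [h + x]addrC; apply: Hd.
have c0 : continuous (\0 : {linear V -> W}) by move=> y; apply: cst_continuous.
have d0 := diff_unique c0 ex.
by split; [apply/diff_locallyP; rewrite d0 | rewrite d0].
Qed.

End Differentiable0.

Section CriticalPoint.
Variables (R : realType) (m n : nat) (f : 'M[R]_(m, n) -> R) (x : 'M[R]_(m, n)).
Local Open Scope classical_set_scope.

(** On a ray [t *: H] the error is o(t) while [L] is exactly linear in [t], so a zero differential
    forces [L H = 0]. *)
Lemma critical_pointP (L : 'M[R]_(m, n) -> R) :
  (forall t H, L (t *: H) = t * L H) ->
  (forall eta, 0 < eta -> exists2 d, 0 < d & forall H, H != 0 -> `|H| < d ->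
    `|f (x + H) - f x - L H| <= eta * `|H|) ->
  (differentiable f x /\ 'd f x = (fun=> 0) :> (_ -> R)) <-> (forall H, L H = 0).
Proof.
move=> LZ fL; have L0 : L 0 = 0 by rewrite -[X in L X](scale0r 0) LZ mul0r.
split=> [[df d0] H|LH0].
  have [->//|H0] := eqVneq H 0; apply/eqP; apply: contraT => LH.
  have nH : 0 < `|H| by rewrite normr_gt0.
  have nL : 0 < `|L H| by rewrite normr_gt0.
  (* With this tolerance the two errors add up to half of [t * |L H|]. *)
  have eta0 : 0 < `|L H| / (4 * `|H|) by rewrite divr_gt0 ?mulr_gt0.
  have [d1 d10 H1] := fL _ eta0.
  have := diff_locally df => /eqaddoP/(_ _ eta0)/nbhs_norm0P[d2 /= d20 H2].
  pose t := Num.min d1 d2 / (2 * `|H|).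
  have t0 : 0 < t by rewrite divr_gt0 ?lt_min ?d10 ?d20 ?mulr_gt0.
  have ntH : `|t *: H| = t * `|H| by rewrite normrZ gtr0_norm.
  have tH : t * `|H| = Num.min d1 d2 / 2 by rewrite /t; field; rewrite gt_eqF.
  have mm : Num.min d1 d2 / 2 < Num.min d1 d2.
    by rewrite ltr_pdivrMr // ltr_pMr ?ltr1n // lt_min d10.
  have small : `|t *: H| < Num.min d1 d2 by rewrite ntH tH.
  move: (small); rewrite lt_min => /andP[s1 s2].
  have tH0 : t *: H != 0 by rewrite scaler_eq0 negb_or gt_eqF.
  have := H1 _ tH0 s1; have := H2 _ s2; rewrite /= !fctE d0 addr0 addrC ntH LZ.
  rewrite [t *: H + x]addrC.
  have -> : `|L H| / (4 * `|H|) * (t * `|H|) = t * `|L H| / 4.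
    by field; rewrite gt_eqF.
  move: (f _) (f x) => u v; rewrite [- v + u]addrC.
  have nt : `|t * L H| = t * `|L H| by rewrite normrM gtr0_norm.
  move=> h1 h2; have : t * `|L H| <= t * `|L H| / 4 + t * `|L H| / 4.
    rewrite -{1}nt; have -> : t * L H = (u - v) - (u - v - t * L H) by ring.
    by apply: le_trans (ler_normB _ _) _; apply: lerD.
  have : 0 < t * `|L H| by rewrite mulr_gt0.
  by set z := t * _ => z0 h; exfalso; move: h; apply/negP; rewrite -ltNge; lra.
apply: differentiable0 => e e0; have [d d0 Hd] := fL e e0; exists d => // H Hlt.
have [->|H0] := eqVneq H 0; first by rewrite addr0 subrr !normr0 mulr0.
by have := Hd H H0 Hlt; rewrite LH0 subr0.
Qed.

End CriticalPoint.

(** * First-order expansion of the mixed cost *)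

Section MixedCost.
Variables (R : realType) (n m : nat) (A : 'M[R]_n) (B : 'M[R]_(n, m)) (Bw : 'M[R]_n)
  (Q : 'M[R]_n) (Rw : 'M[R]_m) (beta : R).
Hypotheses (Q0 : posdef Q) (R0 : posdef Rw) (beta0 : 0 < beta) (W0 : posdef (Wm Bw)).
Implicit Types (K H : 'M[R]_(m, n)) (X Y T P : 'M[R]_n).

Local Notation g := (beta ^- 2).
Local Notation a K := (AK A B K).
Local Notation S K := (SK Q Rw K).
Local Notation W := (Wm Bw).
Local Notation ricX K := (ric (a K)^T (g *: S K) W).
Local Notation closed K X := ((a K)^T + g *: S K *m X).
Local Notation J := (Jmix A B Bw Q Rw beta).
Local Notation stable := (stab_sol_X A B Bw Q Rw beta).

Let g0 : 0 < g. Proof. by rewrite invr_gt0 exprn_gt0. Qed.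
Let sRw : Rw^T = Rw := posdef_sym R0.
Let sQ : Q^T = Q := posdef_sym Q0.
Let sW : W^T = W := posdef_sym W0.

Lemma SK_posdef K : posdef (S K).
Proof. by apply: posdef_psdD => //; apply: psd_congr; apply: posdef_psd. Qed.

Let sS K : (S K)^T = S K := posdef_sym (SK_posdef K).

Lemma gSK_posdef K : posdef (g *: S K).
Proof. by apply: posdefZ => //; apply: SK_posdef. Qed.

Lemma ricXE K X : ricX K X = a K *m X + X *m (a K)^T + g *: (X *m S K *m X) + W.
Proof. by rewrite /ric trmxK -scalemxAr -scalemxAl [a K *m X + _]addrC. Qed.

Lemma closed_tr K X : X^T = X -> (closed K X)^T = a K + g *: (X *m S K).
Proof. by move=> sX; rewrite linearD /= trmxK trmx_mul linearZ /= sS sX -scalemxAr. Qed.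

Lemma stableP K X : stable K X <->
  [/\ possemidef X, ricX K X = 0 & hurwitz (closed K X)].
Proof.
rewrite ricXE; split=> [[X0 [e h]]|[X0 e h]].
  have := hurwitz_tr h; rewrite -(closed_tr _ (psd_sym X0)) trmxK => h'.
  by split; [exact: X0 | exact: e | exact: h'].
have := hurwitz_tr h; rewrite (closed_tr _ (psd_sym X0)) => h'.
exact: (conj X0 (conj e h')).
Qed.

Lemma XK_eq K X : stable K X -> XK A B Bw Q Rw beta K = X.
Proof.
move=> sX; have : stable K (XK A B Bw Q Rw beta K).
  by apply: ClassicalEpsilon.epsilon_spec; exists X.
move: sX => /stableP[X0 rX hX] /stableP[X0' rX' hX'].
exact: (ric_unique (posdef_sym (gSK_posdef K)) (psd_sym X0') rX' rX hX' hX).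
Qed.

Lemma Jmix_eq K X : stable K X -> J K = \tr (S K *m X).
Proof. by move=> sX; rewrite /Jmix (XK_eq sX). Qed.

Definition dSK K H : 'M[R]_n := H^T *m Rw *m K + K^T *m Rw *m H.

Lemma AKD K H : a (K + H) = a K + B *m H.
Proof. by rewrite /AK mulmxDr addrA. Qed.

Lemma SKD K H : S (K + H) = S K + dSK K H + H^T *m Rw *m H.
Proof. by rewrite /SK /dSK [(K + H)^T]linearD /=; mxring. Qed.

Lemma dSK_sym K H : (dSK K H)^T = dSK K H.
Proof. by rewrite /dSK linearD /= !trmx_mul !trmxK sRw !mulmxA addrC. Qed.

(** Derivative of [ricX] in the direction [H] of the controller, with [X] frozen. *)
Definition forcing K X H : 'M[R]_n :=
  B *m H *m X + X *m H^T *m B^T + g *: (X *m dSK K H *m X).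

Lemma forcing_sym K X H : X^T = X -> (forcing K X H)^T = forcing K X H.
Proof.
move=> sX; rewrite /forcing; move: (dSK K H) (dSK_sym K H) => d sd.
rewrite !linearD linearZ /= !trmx_mul !trmxK sX sd !mulmxA.
by rewrite [X in X + _]addrC.
Qed.

Definition remainder K X T H : 'M[R]_n :=
  T *m H^T *m B^T + B *m H *m T + g *: (T *m S K *m T) +
  g *: (X *m dSK K H *m T) + g *: (T *m dSK K H *m X) + g *: (T *m dSK K H *m T) +
  g *: ((X + T) *m (H^T *m Rw *m H) *m (X + T)).

Lemma ricX_expand K X T H : X^T = X ->
  ricX (K + H) (X + T) =
    ricX K X + lyap (closed K X) T + forcing K X H + remainder K X T H.
Proof.
move=> sX; rewrite !ricXE /lyap closed_tr // AKD SKD /forcing /remainder.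
rewrite [(a K + _)^T]linearD /= trmx_mul.
move: (dSK K H) (a K) (S K) => dS aK SK0; mxring.
Qed.

Section Expansion.
Variables (K : 'M[R]_(m, n)) (X : 'M[R]_n).
Hypotheses (Xp : posdef X) (rX : ricX K X = 0) (hX : hurwitz (closed K X)).

Let sX : X^T = X := posdef_sym Xp.
Let F := closed K X.

Definition dX H : 'M[R]_n := lyap_sol F (- forcing K X H).

(** Adding [c *: margin] to [X] shifts the linear part of [ricX] by [- c] times the identity; this
    room absorbs the second-order remainder. *)
Definition margin : 'M[R]_n := lyap_sol F (- 1%:M).

Definition dJ H : R := \tr (dSK K H *m X) + \tr (S K *m dX H).

Let sdX H : (dX H)^T = dX H.
Proof. by apply: lyap_sol_sym => //; rewrite linearN /= forcing_sym. Qed.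

Lemma margin_posdef : posdef margin.
Proof.
have sm : margin^T = margin by apply: lyap_sol_sym => //; rewrite linearN /= trmx1.
by apply: (lyap_posdef hX) => //; rewrite lyap_solP // opprK; exact: posdef1.
Qed.

Let step e H : 'M[R]_n := dX H + (e * `|H|) *: margin.

Let sstep e H : (step e H)^T = step e H.
Proof. by rewrite linearD linearZ /= sdX (posdef_sym margin_posdef). Qed.

Lemma order_dSK : order 1 (dSK K).
Proof.
apply: orderD; last exact/orderM0l/order_id.
exact/orderM0r/orderM0r/orderT/order_id.
Qed.

Lemma order_quad : order 2 (fun H => H^T *m Rw *m H).
Proof. by apply: (@orderM _ _ _ 1 1); [exact/orderM0r/orderT/order_id|exact: order_id]. Qed.

Lemma order_dX : order 1 dX.
Proof.
apply/order_lyap_sol/orderN/orderD; last exact/orderZ/orderM0r/orderM0l/order_dSK.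
apply: orderD; first exact/orderM0r/orderM0l/order_id.
exact/orderM0r/orderM0l/orderT/order_id.
Qed.

Lemma order_step e : order 1 (step e).
Proof. by apply: orderD; [exact: order_dX | exact: order_normZ]. Qed.

Let order_shifted e : order 0 (fun H => X + step e H).
Proof. by apply: orderD; [exact: order_cst | apply: order_weak (order_step e)]. Qed.

Lemma order_remainder e : order 2 (fun H => remainder K X (step e H) H).
Proof.
have oT := order_step e; have oS := order_dSK; have oZ := order_shifted e.
have oid : order 1 (fun H => H) by exact: order_id.
rewrite /remainder; do 6?apply: orderD.
- by apply/orderM0r/(@orderM _ _ _ 1 1)/orderT.
- by apply: (@orderM _ _ _ 1 1) => //; apply: orderM0l.
- by apply/orderZ/(@orderM _ _ _ 1 1) => //; apply: orderM0r.
- by apply/orderZ/(@orderM _ _ _ 1 1) => //; apply: orderM0l.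
- by apply/orderZ/orderM0r/(@orderM _ _ _ 1 1).
- apply/orderZ/(@order_weak _ _ _ 3 2) => //; apply: (@orderM _ _ _ 2 1) => //.
  exact: (@orderM _ _ _ 1 1).
- apply/orderZ; apply: (@orderM _ _ _ 2 0) => //.
  by apply: (@orderM _ _ _ 0 2) => //; exact: order_quad.
Qed.

Let ric_step e H : ricX (K + H) (X + step e H) =
  - (e * `|H|) *: 1%:M + remainder K X (step e H) H.
Proof.
rewrite ricX_expand // rX /step lyapD lyapZ !lyap_solP //.
by apply/matrixP => i j; mxentry; ring.
Qed.

Let closed_drift e H : 'M[R]_n :=
  H^T *m B^T + g *: (S K *m step e H) + g *: (dSK K H *m (X + step e H)) +
  g *: (H^T *m Rw *m H *m (X + step e H)).

Let closed_step e H : closed (K + H) (X + step e H) = F + closed_drift e H.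
Proof.
rewrite /F /closed_drift AKD SKD [(a K + _)^T]linearD /= trmx_mul.
by move: (dSK K H) (a K) (S K) (step e H) => dS aK SK0 T; mxring.
Qed.

Lemma order_closed_drift e : order 1 (closed_drift e).
Proof.
have oZ := order_shifted e.
have oid : order 1 (fun H => H) by exact: order_id.
do 3?apply: orderD.
- exact/orderM0r/orderT.
- exact/orderZ/orderM0l/order_step.
- by apply/orderZ/(@orderM _ _ _ 1 0) => //; exact: order_dSK.
- apply/orderZ/(@order_weak _ _ _ 2 1) => //.
  by apply: (@orderM _ _ _ 2 0) => //; exact: order_quad.
Qed.

(* X + dX H is corrected by +/- e |H| margin into a strict super- and subsolution of
   the Riccati equation at K + H, which trap its stabilizing solution. *)
Lemma stable_near e : 0 < e -> exists2 d, 0 < d & forall H, H != 0 -> `|H| < d ->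
  exists X', [/\ stable (K + H) X', possemidef (X + step e H - X') &
    possemidef (X' - (X + step (- e) H))].
Proof.
move=> e0.
(* [d1] keeps the upper candidate definite, [d2] and [d3] make the remainder smaller than [e |H|],
   and [d4] lets the certificate of the unperturbed closed loop work for the lower candidate. *)
have [d1 d10 H1] := order1_posdef Xp (sstep e) (order_step e).
have srem f H : (remainder K X (step f H) H)^T = remainder K X (step f H) H.
  have sZ : (X + step f H)^T = X + step f H by rewrite linearD /= sX sstep.
  rewrite /remainder; move: (dSK K H) (dSK_sym K H) (S K) (sS K) => d sd SK0 sSK0.
  move: (step f H) (sstep f H) => T sT.
  by rewrite !linearD !linearZ /= !trmx_mul !linearD /= !trmxK sT sX sd sSK0 sRw; mxring.
have srem' H : (- remainder K X (step e H) H)^T = - remainder K X (step e H) H.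
  by rewrite linearN /= srem.
have [d2 d20 H2] := order2_posdef e0 srem' (orderN (order_remainder e)).
have [d3 d30 H3] := order2_posdef e0 (srem (- e)) (order_remainder (- e)).
have [P P0 LP] := hurwitz_certified hX.
have sL H : (- lyap (closed_drift (- e) H) P)^T = - lyap (closed_drift (- e) H) P.
  by rewrite linearN /= lyap_tr (posdef_sym P0).
have oL : order 1 (fun H => - lyap (closed_drift (- e) H) P).
  have o := order_closed_drift (- e).
  by apply/orderN/orderD; [exact/orderM0r/orderT | exact/orderM0l].
have [d4 d40 H4] := order1_posdef LP sL oL.
exists (Num.min (Num.min d1 d2) (Num.min d3 d4)); first by rewrite !lt_min d10 d20 d30 d40.
move=> H Hn0; rewrite !lt_min => /andP[/andP[l1 l2] /andP[l3 l4]].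
have Zp := H1 H l1.
have rZp : posdef (- ricX (K + H) (X + step e H)).
  by rewrite ric_step opprD scaleNr opprK; exact: H2.
have [X' [X'p rX' hX' ub]] := dual_solution W0 (gSK_posdef (K + H)) Zp rZp.
exists X'; split; [|exact: ub|].
  by apply/stableP; split; [exact: posdef_psd | exact: rX' | exact: hX'].
have sZ : (X + step (- e) H)^T = X + step (- e) H by rewrite linearD /= sX sstep.
apply: (dual_lower (gSK_posdef (K + H)) sZ (posdef_sym X'p) _ _ rX').
  rewrite closed_step; apply: certified_hurwitz; exists P => //.
  by rewrite lyapDl opprD; exact: H4.
by rewrite ric_step mulNr opprK; apply: posdef_psd; exact: H3.
Qed.

Lemma trace_step e : exists2 c, 0 <= c & forall H, `|H| <= 1 ->
  `|\tr (S (K + H) *m (X + step e H)) - \tr (S K *m X) - dJ H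
    - e * `|H| * \tr (S K *m margin)| <= c * `|H| ^+ 2.
Proof.
have o : order 2 (fun H => dSK K H *m step e H + H^T *m Rw *m H *m (X + step e H)).
  apply: orderD; first by apply: (@orderM _ _ _ 1 1); [exact: order_dSK | exact: order_step].
  by apply: (@orderM _ _ _ 2 0); [exact: order_quad | exact: order_shifted].
have [c c0 Hc] := order_trace o; exists c => // H /Hc; congr (`|_| <= _).
have -> : S (K + H) *m (X + step e H) = S K *m X + dSK K H *m X + S K *m dX H +
  (e * `|H|) *: (S K *m margin) + (dSK K H *m step e H + H^T *m Rw *m H *m (X + step e H)).
  rewrite SKD {1}/step; move: (dSK K H) (S K) => dS SK0; rewrite /step; mxring.
rewrite !mxtraceD mxtraceZ /dJ; ring.
Qed.

(** The trace against the definite [S (K + H)] is monotone, so the two-sided trap of the solution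
    becomes a two-sided bound on the cost. *)
Lemma Jmix_expansion eta : 0 < eta -> exists2 d, 0 < d & forall H, H != 0 -> `|H| < d ->
  `|J (K + H) - J K - dJ H| <= eta * `|H|.
Proof.
move=> eta0; set t := \tr (S K *m margin).
have t0 : 0 <= t by apply: mxtrace_posdef_psd; [exact: SK_posdef | exact/posdef_psd/margin_posdef].
have t1 : 0 < 2 * (t + 1) by lra.
(* Half of the tolerance pays for the margin through [e], the other half for the quadratic error
   through the radius. *)
have e0 := divr_gt0 eta0 t1; set e := eta / _ in e0.
have et : e * t <= eta / 2.
  have -> : eta / 2 = e * (t + 1) by rewrite /e; field; lra.
  by rewrite ler_pM2l //; lra.
have [d1 d10 H1] := stable_near e0.
have [c c0 Hc] := trace_step e; have [c' c'0 Hc'] := trace_step (- e).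
have cc : 0 < 2 * (c + c' + 1) by lra.
exists (Num.min (Num.min d1 1) (eta / (2 * (c + c' + 1)))).
  by rewrite !lt_min d10 ltr01 divr_gt0.
move=> H Hn0; rewrite !lt_min ltr_pdivlMr // => /andP[/andP[l1 l2] l3].
have [X' [sX' ub lb]] := H1 H Hn0 l1.
have KX : stable K X.
  by apply/stableP; split; [exact: posdef_psd | exact: rX | exact: hX].
rewrite (Jmix_eq sX') (Jmix_eq KX).
have := mxtrace_posdef_psd (SK_posdef (K + H)) ub; rewrite mulmxBr linearB /= => u.
have := mxtrace_posdef_psd (SK_posdef (K + H)) lb; rewrite mulmxBr linearB /= => l.
have := Hc H (ltW l2); have := Hc' H (ltW l2).
have h0 := normr_ge0 H; rewrite -/t; move: l3 u l.
move: (\tr _) (\tr _) (\tr _) (\tr _) => x1 x2 x3 x4 l3 u l.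
rewrite !ler_norml => /andP[p1 p2] /andP[p3 p4].
have b1 : c * `|H| ^+ 2 <= eta / 2 * `|H| by rewrite expr2; nra.
have b2 : c' * `|H| ^+ 2 <= eta / 2 * `|H| by rewrite expr2; nra.
have b3 : e * `|H| * t <= eta / 2 * `|H| by rewrite mulrAC ler_wpM2r.
by apply/andP; split; lra.
Qed.

End Expansion.
End MixedCost.

(** * From the adjoint equation to the control Riccati equation *)

Section ControlRiccati.
Variables (R : realType) (n : nat) (a S W X : 'M[R]_n) (g : R).
Hypotheses (S0 : posdef S) (g0 : 0 < g) (X0 : posdef X).
Let F := a^T + g *: S *m X.
Hypotheses (rX : ric a^T (g *: S) W X = 0) (hF : hurwitz F).

(** Lagrange multiplier of the Riccati constraint on [X]. *)
Definition adjoint_sol : 'M[R]_n := lyap_sol F^T (- S).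
Local Notation Y := adjoint_sol.

(** The derivative of the cost produces R K X + B^T Y X + g R K X Y X; factoring out Y X on the
    right leaves R K (Y^-1 + g X) + B^T. *)
Definition precontrol_sol : 'M[R]_n := invmx Y + g *: X.
Local Notation M := precontrol_sol.

Lemma lyap_adjoint : F *m Y + Y *m F^T = - S.
Proof. by have := lyap_solP (- S) (hurwitz_tr hF); rewrite /lyap trmxK. Qed.

Lemma adjoint_sol_posdef : posdef Y.
Proof.
have hF' := hurwitz_tr hF.
have sY : Y^T = Y by apply: lyap_sol_sym => //; rewrite linearN /= posdef_sym.
by apply: (lyap_posdef hF' sY); rewrite lyap_solP // opprK.
Qed.

Lemma precontrol_sol_posdef : posdef M.
Proof.
apply: posdef_psdD; first exact: posdef_inv adjoint_sol_posdef.
by apply: posdef_psd; apply: posdefZ.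
Qed.

Let Yu : Y \in unitmx := posdef_unit adjoint_sol_posdef.
Let Mu : M \in unitmx := posdef_unit precontrol_sol_posdef.

Let tF : F^T = a + g *: X *m S.
Proof.
rewrite /F linearD /= trmxK trmx_mul linearZ /= (posdef_sym S0) (posdef_sym X0).
by rewrite -scalemxAr -scalemxAl.
Qed.

Let adjoint_inv : F^T *m invmx Y + invmx Y *m F + invmx Y *m S *m invmx Y = 0.
Proof.
have := congr1 (fun T => invmx Y *m T *m invmx Y) lyap_adjoint.
rewrite mulmxDr mulmxDl !mulmxA mulVmx // mul1mx -(mulmxA _ Y) mulmxV // mulmx1.
by rewrite mulmxN mulNmx addrC => ->; rewrite [_ + _ *m S *m _]addrC subrr.
Qed.

(** This is the adjoint equation conjugated by the inverse of [Y], plus [g] times the equation of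
    [X]: the [g S X] inside [F] supplies the mixed terms. *)
Lemma precontrol_ric : ric a^T S (g *: W) M = 0.
Proof.
have -> : ric a^T S (g *: W) M =
  (F^T *m invmx Y + invmx Y *m F + invmx Y *m S *m invmx Y) + g *: ric a^T (g *: S) W X.
  by rewrite /ric trmxK tF /F /M; move: (invmx Y) => Z; mxring.
by rewrite adjoint_inv rX scaler0 addr0.
Qed.

Lemma control_ric : ric a (g *: W) S (invmx M) = 0.
Proof. by rewrite ric_inv // precontrol_ric mulmx0 mul0mx. Qed.

(** Conjugation by [Y] and then by [M] carries [F^T] to this closed loop. *)
Lemma control_hurwitz : hurwitz (a + g *: W *m invmx M).
Proof.
have e1 : (a + g *: W *m invmx M) *m M = - (M *m (F + S *m invmx Y)).
  rewrite mulmxDl -mulmxA mulVmx // mulmx1; apply/eqP; rewrite -addr_eq0; apply/eqP.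
  rewrite -precontrol_ric /ric trmxK /F /M; move: (invmx Y) => Z; mxring.
have e2 : F + S *m invmx Y = - (Y *m F^T *m invmx Y).
  have := congr1 (mulmx Y) adjoint_inv.
  rewrite !mulmxDr !mulmxA mulmxV // !mul1mx mulmx0 => /eqP.
  by rewrite -addrA addrC addr_eq0 => /eqP.
have -> : a + g *: W *m invmx M = M *m (Y *m F^T *m invmx Y) *m invmx M.
  by rewrite -[LHS](mulmxK Mu) e1 e2 mulmxN opprK.
by apply: (hurwitz_sim Mu); apply: (hurwitz_sim Yu); exact: hurwitz_tr.
Qed.

End ControlRiccati.

(** * The gradient of the mixed cost *)

Section Gradient.
Variables (R : realType) (n m : nat) (A : 'M[R]_n) (B : 'M[R]_(n, m)) (Bw : 'M[R]_n)
  (Q : 'M[R]_n) (Rw : 'M[R]_m) (beta : R).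
Hypotheses (Q0 : posdef Q) (R0 : posdef Rw) (beta0 : 0 < beta) (W0 : posdef (Wm Bw)).
Variables (K : 'M[R]_(m, n)) (X : 'M[R]_n).
Local Notation g := (beta ^- 2).
Local Notation S := (SK Q Rw K).
Local Notation F := ((AK A B K)^T + g *: S *m X).
Hypotheses (X0 : posdef X) (hF : hurwitz F).
Local Notation Y := (adjoint_sol (AK A B K) S X g).
Local Notation M := (precontrol_sol (AK A B K) S X g).

Definition gradient : 'M[R]_(m, n) := (Rw *m K *m M + B^T) *m Y *m X.

(** The Lyapunov operators of [F] and [F^T] are adjoint under the trace, which trades [dX] for [Y];
    transposition and cyclicity then pair equal terms. *)
Lemma dJ_gradient H : dJ A B Q Rw beta K X H = \tr (H^T *m gradient) *+ 2.
Proof.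
have S0 := SK_posdef Q0 R0 K; have sX := posdef_sym X0; have sR := posdef_sym R0.
have Y0 := adjoint_sol_posdef S0 hF; have Yu := posdef_unit Y0; have sY := posdef_sym Y0.
have sE := forcing_sym B beta R0 K H sX.
have trT (T : 'M[R]_n) : \tr T^T = \tr T by exact: mxtrace_tr.
have tS : \tr (S *m dX A B Q Rw beta K X H) = \tr (Y *m forcing B Rw beta K X H).
  have := lyap_solP (- forcing B Rw beta K X H) hF; rewrite /lyap -/(dX A B Q Rw beta K X H).
  have := lyap_adjoint hF; move: (dX _ _ _ _ _ _ _ _) F Y => D F' Y' eY eD.
  rewrite -[forcing _ _ _ _ _ _]opprK -eD -[X in \tr (X *m D)]opprK -eY.
  rewrite mulNmx mulmxN !linearN /= mulmxDl mulmxDr !linearD /= -mulmxA mxtrace_mulC.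
  by rewrite !mulmxA addrC.
rewrite /dJ tS /forcing /dSK /gradient /precontrol_sol.
rewrite !(mulmxDr, mulmxDl, mxtraceD, =^~ scalemxAl, =^~ scalemxAr, mxtraceZ, mulmxA).
rewrite -(mulmxA _ (invmx Y) Y) mulVmx // mulmx1.
have t1 : \tr (K^T *m Rw *m H *m X) = \tr (H^T *m Rw *m K *m X).
  by rewrite -trT !trmx_mul trmxK sR sX mxtrace_mulC !mulmxA.
have t2 : \tr (Y *m B *m H *m X) = \tr (H^T *m B^T *m Y *m X).
  by rewrite -trT !trmx_mul sY sX mxtrace_mulC !mulmxA.
have t3 : \tr (Y *m X *m H^T *m B^T) = \tr (H^T *m B^T *m Y *m X).
  by rewrite -[_ *m H^T *m _]mulmxA mxtrace_mulC !mulmxA.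
have t4 : \tr (Y *m X *m H^T *m Rw *m K *m X) = \tr (H^T *m Rw *m K *m X *m Y *m X).
  rewrite -!mulmxA [LHS]mxtrace_mulC -!mulmxA [LHS]mxtrace_mulC; congr (\tr _).
  by rewrite !mulmxA.
have t5 : \tr (Y *m X *m K^T *m Rw *m H *m X) = \tr (H^T *m Rw *m K *m X *m Y *m X).
  by rewrite -trT !trmx_mul trmxK sR sX sY mxtrace_mulC !mulmxA.
rewrite t1 t2 t3 t4 t5; ring.
Qed.

Lemma dJ_eq0 : (forall H, dJ A B Q Rw beta K X H = 0) <-> K = - (invmx Rw *m B^T *m invmx M).
Proof.
have S0 := SK_posdef Q0 R0 K; have Xu := posdef_unit X0.
have g0 : 0 < g by rewrite invr_gt0 exprn_gt0.
have Yu := posdef_unit (adjoint_sol_posdef S0 hF).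
have Mu := posdef_unit (precontrol_sol_posdef S0 g0 X0 hF).
have Ru := posdef_unit R0.
have Geq (M' : 'M[R]_n) : M' \in unitmx ->
    (K = - (invmx Rw *m B^T *m invmx M')) <-> Rw *m K *m M' + B^T = 0.
  move=> Mu'; split=> [->|].
    by rewrite mulmxN mulNmx !mulmxA mulmxV // mul1mx mulmxKV // addNr.
  move/eqP; rewrite addr_eq0 => /eqP e.
  by rewrite -mulmxA -[B^T]opprK -e mulNmx mulmxK // mulmxN opprK mulKmx.
split=> [H0|/(Geq _ Mu) G0 H]; last first.
  by rewrite dJ_gradient /gradient G0 !mul0mx mulmx0 mxtrace0 mul0rn.
(* Testing in the direction of the gradient leaves the trace of its Gram matrix. *)
apply/(Geq _ Mu); have := H0 gradient; rewrite dJ_gradient => /eqP; rewrite mulrn_eq0 /= => /eqP.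
move/mxtrace_square_eq0 => G0.
have : gradient *m invmx X *m invmx Y = 0 by rewrite G0 !mul0mx.
by rewrite /gradient mulmxK // mulmxK.
Qed.

End Gradient.

(** * The central controller and uniqueness *)

Section CentralController.
Variables (R : realType) (n m : nat) (A : 'M[R]_n) (B : 'M[R]_(n, m)) (Bw : 'M[R]_n)
  (Q : 'M[R]_n) (Rw : 'M[R]_m) (beta : R).
Hypotheses (Q0 : posdef Q) (R0 : posdef Rw) (beta0 : 0 < beta) (W0 : posdef (Wm Bw)).
Implicit Types (K : 'M[R]_(m, n)) (X P : 'M[R]_n).
Local Notation g := (beta ^- 2).
Local Notation a K := (AK A B K).
Local Notation S K := (SK Q Rw K).
Local Notation W := (Wm Bw).
Local Notation V := (g *: W - B *m invmx Rw *m B^T).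
Local Notation central P := (- (invmx Rw *m B^T *m P)).

Let g0 : 0 < g. Proof. by rewrite invr_gt0 exprn_gt0. Qed.
Let sRi : (invmx Rw)^T = invmx Rw. Proof. by apply/invmx_sym/posdef_sym. Qed.
Let sW : W^T = W := posdef_sym W0.
Let sV : V^T = V.
Proof. by rewrite linearB linearZ /= sW !trmx_mul trmxK sRi mulmxA. Qed.

Lemma CK_gram K : (CK Q Rw K)^T *m CK Q Rw K = S K.
Proof.
have [sq eq] := msqrtP Q0; have [sr er] := msqrtP R0.
rewrite /CK tr_col_mx mul_row_col trmx_mul (psd_sym sq) (psd_sym sr) eq.
by rewrite mulmxA -(mulmxA K^T) er.
Qed.

Lemma Kbeta_strict K : Kbeta A B Bw Q Rw beta K ->
  exists2 N : 'M[R]_n, N^T = N & posdef (- ric (a K) W (g *: S K) N).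
Proof.
move=> [hK tK]; have SS0 : posdef ((CK Q Rw K)^T *m CK Q Rw K).
  by rewrite CK_gram; exact: SK_posdef.
have [N sN N0] := hinf_strict W0 SS0 beta0 hK tK.
by exists N => //; move: N0; rewrite CK_gram.
Qed.

Lemma strict_Kbeta K N : hurwitz (a K) -> N^T = N ->
  posdef (- ric (a K) W (g *: S K) N) -> Kbeta A B Bw Q Rw beta K.
Proof.
move=> hK sN N0; split=> //; apply: strict_hinf => //.
by exists N => //; rewrite CK_gram.
Qed.

Lemma Kbeta_supersolution K : Kbeta A B Bw Q Rw beta K ->
  exists2 Xp, posdef Xp & posdef (- ric (a K)^T (g *: S K) W Xp).
Proof.
move=> KK; have [N sN N0] := Kbeta_strict KK.
have [Np Xp] := strict_subsolution_inv W0 (gSK_posdef Q0 R0 beta0 K) KK.1 sN N0.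
by exists (invmx N) => //; apply: posdef_inv.
Qed.

Lemma Kbeta_stable K : Kbeta A B Bw Q Rw beta K ->
  exists X, [/\ posdef X, ric (a K)^T (g *: S K) W X = 0 &
    hurwitz ((a K)^T + g *: S K *m X)].
Proof.
move=> /Kbeta_supersolution[Xp Xp0 rXp].
have [X [X0 rX hX _]] := dual_solution W0 (gSK_posdef Q0 R0 beta0 K) Xp0 rXp.
by exists X.
Qed.

Lemma stab_sol_PE P : stab_sol_P A B Bw Q Rw beta P <->
  [/\ P^T = P, ric A V Q P = 0 & hurwitz (A + V *m P)].
Proof.
rewrite /stab_sol_P /Defs.symmetric /ric (addrC (P *m A)).
by split=> [[? [? ?]]|[? ? ?]].
Qed.

Lemma central_closed P : a (central P) + g *: W *m P = A + V *m P.
Proof. by rewrite /AK; mxring. Qed.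

(** For the central gain the cross terms and K^T R K collapse to -P B R^-1 B^T P, the controller
    part of [V]. *)
Lemma central_ric P : P^T = P ->
  ric (a (central P)) (g *: W) (S (central P)) P = ric A V Q P.
Proof.
move=> sP; have Ru := posdef_unit R0.
have sK : (central P)^T = - (P *m B *m invmx Rw).
  by rewrite linearN /= !trmx_mul trmxK sRi sP mulmxA.
have sa : (a (central P))^T = A^T - P *m B *m invmx Rw *m B^T.
  by rewrite /AK linearD /= trmx_mul sK mulNmx.
have e : - (P *m B *m invmx Rw) *m Rw *m central P = P *m B *m invmx Rw *m B^T *m P.
  by rewrite !mulmxN !mulNmx opprK !mulmxA mulmxKV.
rewrite /ric sa /SK sK e /AK; move: (invmx Rw) => Ri; mxring.
Qed.

Lemma stab_sol_P_unique P P' : stab_sol_P A B Bw Q Rw beta P ->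
  stab_sol_P A B Bw Q Rw beta P' -> P = P'.
Proof.
move=> /stab_sol_PE[sP rP hP] /stab_sol_PE[sP' rP' hP'].
exact: (ric_unique sV sP rP rP' hP hP').
Qed.

(* Completing the square in K eliminates the controller from the strict inequality for
   g X, leaving the control Riccati inequality for the inverse of P. *)
Lemma stab_sol_P_exists K : Kbeta A B Bw Q Rw beta K ->
  exists2 P, posdef P & stab_sol_P A B Bw Q Rw beta P.
Proof.
move=> /Kbeta_supersolution[Xp Xp0 rXp].
have Ru := posdef_unit R0; have sR := posdef_sym R0; have sX := posdef_sym Xp0.
pose N := g *: Xp.
have N0 : posdef N by apply: posdefZ.
have sN := posdef_sym N0.
(* Deviation of [K] from the minimizer of the square, - R^-1 B^T N^-1, multiplied by [N]. *)
pose E := K *m N + invmx Rw *m B^T.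
have e : - ric A^T Q V N = g *: - ric (a K)^T (g *: S K) W Xp + E^T *m Rw *m E.
  have -> : E^T *m Rw *m E = N *m K^T *m Rw *m K *m N + B *m K *m N + N *m K^T *m B^T
      + B *m invmx Rw *m B^T.
    have -> : E^T = N *m K^T + B *m invmx Rw by rewrite linearD /= !trmx_mul trmxK sRi sN.
    rewrite /E !(mulmxDl, mulmxDr) !mulmxA !(mulmxKV Ru) !(mulmxK Ru).
    by apply/matrixP => i j; mxentry; ring.
  rewrite /ric /AK /SK /N !trmxK [(A + _)^T]linearD /= trmx_mul.
  by move: (invmx Rw) => Ri; mxring.
have rN : posdef (- ric A^T Q V N).
  rewrite e; apply: posdef_psdD; first exact: posdefZ.
  by apply/psd_congr/posdef_psd.
(* For the inverse unknown the quadratic coefficient is [Q], and the indefinite [V] is the constant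
   term. *)
have [M [sM rM hM MN]] := riccati_solution Q0 sV sN rN.
have M0 : posdef M by rewrite -(subrK N M); apply: posdef_psdD => //; exact: posdef_psd.
have Mu := posdef_unit M0; have P0 := posdef_inv M0.
have rP : ric A V Q (invmx M) = 0 by rewrite ric_inv // rM mulmx0 mul0mx.
exists (invmx M); first exact: P0.
apply/stab_sol_PE; split; [exact: posdef_sym | exact: rP |].
have rP' : ric A^T^T V Q (invmx M) = 0 by rewrite trmxK.
have := ric_inv_similar P0 rP'; rewrite trmxK invmxK => ->.
exact: hurwitz_sim Mu hM.
Qed.

(** [P] certifies that [a K] is Hurwitz, and [g *: P] solves the bounded real equation with a
    Hurwitz closed loop, from which a first-order step reaches a strict subsolution. *)
Lemma central_Kbeta P : posdef P -> stab_sol_P A B Bw Q Rw beta P ->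
  Kbeta A B Bw Q Rw beta (central P).
Proof.
move=> P0 /stab_sol_PE[sP rP hP].
rewrite -(central_ric sP) in rP; rewrite -(central_closed P) in hP.
set K := central P in rP hP *.
have S0 := SK_posdef Q0 R0 K.
have hK : hurwitz (a K).
  apply: certified_hurwitz; exists P; first exact: P0.
  have -> : - lyap (a K) P = S K + g *: (P *m W *m P) - ric (a K) (g *: W) (S K) P.
    by rewrite /ric /lyap; mxring.
  rewrite rP subr0; apply: (posdef_psdD S0); apply: psdZ; first exact: ltW.
  exact: psd_sandwich.
have rN : ric (a K) W (g *: S K) (g *: P) = 0.
  have -> : ric (a K) W (g *: S K) (g *: P) = g *: ric (a K) (g *: W) (S K) P.
    by rewrite /ric; mxring.
  by rewrite rP scaler0.
have sN : (g *: P)^T = g *: P by rewrite linearZ /= sP.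
have eW : W *m (g *: P) = g *: W *m P by rewrite -(scalemxAr g W P) (scalemxAl g W P).
have hF : hurwitz (a K + W *m (g *: P)) by rewrite eW; exact: hP.
have sE : (lyap_sol (a K + W *m (g *: P)) (- 1%:M))^T = lyap_sol (a K + W *m (g *: P)) (- 1%:M).
  by apply: (lyap_sol_sym hF); rewrite linearN /= trmx1.
have [N sN' N0] := ric_solve_strict W0 sN rN sE (lyap_solP _ hF).
exact: (strict_Kbeta hK sN' N0).
Qed.

Lemma dJ_homogeneous K X t H : X^T = X -> hurwitz ((a K)^T + g *: S K *m X) -> posdef X ->
  dJ A B Q Rw beta K X (t *: H) = t * dJ A B Q Rw beta K X H.
Proof.
move=> sX hX X0; rewrite !(dJ_gradient Q0 R0 X0 hX) linearZ /= -scalemxAl mxtraceZ.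
by rewrite mulrnAr.
Qed.

Lemma stationary_iff P K : posdef P -> stab_sol_P A B Bw Q Rw beta P ->
  stationary A B Bw Q Rw beta K <-> K = central P.
Proof.
move=> P0 sP.
suff key : Kbeta A B Bw Q Rw beta K ->
    (differentiable (Jmix A B Bw Q Rw beta) K /\
     'd (Jmix A B Bw Q Rw beta) K = (fun=> 0) :> (_ -> R)) <-> K = central P.
  split=> [[KK dK]|eK]; first exact/(key KK).
  have KK : Kbeta A B Bw Q Rw beta K by rewrite eK; exact: central_Kbeta.
  exact: (conj KK ((key KK).2 eK)).
move=> /Kbeta_stable[X [X0 rX hX]].
have S0 := SK_posdef Q0 R0 K.
apply: iff_trans.
  apply: critical_pointP; first by move=> t H; exact: (dJ_homogeneous t H (posdef_sym X0) hX X0).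
  by move=> eta eta0; exact: (Jmix_expansion Q0 R0 beta0 W0 X0 rX hX eta0).
apply: iff_trans; first exact: (dJ_eq0 Q0 R0 beta0 X0 hX).
set M := precontrol_sol _ _ _ _.
have M0 : posdef M := precontrol_sol_posdef S0 g0 X0 hX.
have rM : ric (a K) (g *: W) (S K) (invmx M) = 0 := control_ric S0 g0 X0 rX hX.
have hM : hurwitz (a K + g *: W *m invmx M) := control_hurwitz S0 g0 X0 rX hX.
have sM := posdef_sym (posdef_inv M0).
move: (invmx M) sM rM hM => P' sP' rP' hP'.
(* If [K] is central for [P'], the equation attached to [K] is that of [P], whose stabilizing
   solution is unique. *)
split=> eK.
  rewrite [LHS]eK; congr (- (_ *m _)); apply: stab_sol_P_unique sP.
  apply/stab_sol_PE; split; first exact: sP'.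
    by rewrite -(central_ric sP') -eK; exact: rP'.
  by rewrite -(central_closed P') -eK; exact: hP'.
(* If [K] is central for [P], both [P] and [P'] solve the equation attached to [K] with Hurwitz
   closed loops. *)
rewrite [LHS]eK; congr (- (_ *m _)); have [sP1 rP hP] := (stab_sol_PE P).1 sP.
have sgW : (g *: W)^T = g *: W by rewrite linearZ /= sW.
rewrite -(central_ric sP1) -eK in rP; rewrite -(central_closed P) -eK in hP.
exact: (ric_unique sgW sP1 rP rP' hP hP').
Qed.

End CentralController.

Theorem theorem5 (R : realType) (n m : nat)
  (A : 'M[R]_n) (B : 'M[R]_(n, m)) (Bw : 'M[R]_n)
  (Q : 'M[R]_n) (Rw : 'M[R]_m) (beta : R) :
  posdef Q -> posdef Rw -> 0 < beta ->
  (* Assumption 1 *)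
  stabilizable A B -> detectable (msqrt Q) A ->
  inf [set r : R | exists K : 'M[R]_(m, n), Kset A B K /\ r = Tinf_norm A B Bw Q Rw K] < beta ->
  (* Assumption 2 *)
  posdef (Wm Bw) ->
  (exists P : 'M[R]_n, stab_sol_P A B Bw Q Rw beta P) /\
  (forall P : 'M[R]_n, stab_sol_P A B Bw Q Rw beta P ->
     forall K : 'M[R]_(m, n),
       stationary A B Bw Q Rw beta K <-> K = - (invmx Rw *m B^T *m P)).
Proof.
move=> Q0 R0 beta0 [K1 hK1] _ infb W0.
(* Stabilizability makes the set nonempty, so the bound on [inf] yields an actual point of
   [Kbeta]. *)
have [|_ [K0 [hK0 ->]] tK0] := inf_lt _ infb.
  by exists (Tinf_norm A B Bw Q Rw K1), K1.
have [P0 P0p sP0] := stab_sol_P_exists Q0 R0 beta0 W0 (conj hK0 tK0).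
split=> [|P sP K]; first by exists P0.
(* [stab_sol_P] asks only for symmetry; uniqueness transfers the definiteness of [P0] to [P]. *)
have -> : P = P0 by exact: (stab_sol_P_unique R0 W0 sP sP0).
exact: stationary_iff.
Qed.
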